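(* Every unital Kreĭn C*-algebra $\mathscr{A}$ admits at least one faithful representation on a Kreĭn space, and $\mathscr{A}$ is isomorphic (as a unital $*$-algebra) to a closed unital $*$-subalgebra of a Kreĭn C*-algebra of continuous linear operators on a Kreĭn space.
   Context: A (complex) Kreĭn C*-algebra is a complex associative algebra $\mathscr{A}$ with a conjugate-linear involution $*$ satisfying $(x^* )^*=x$ and $(xy)^*=y^*x^*$, that admits at least one Banach (complete algebra) norm $\|\cdot\|$ and at least one $*$-automorphism $\alpha:\mathscr{A}\to\mathscr{A}$ such that $\alpha\circ\alpha=\mathrm{Id}_{\mathscr{A}}$ and $\|\alpha(x^* )x\|=\|x\|^2$ for all $x\in\mathscr{A}$. The norm is not part of the structure. Such an $\alpha$ is called a fundamental symmetry of $\mathscr{A}$. A Kreĭn space is a complex vector space $K$ with a Hermitian sesquilinear form $\langle\cdot\mid\cdot\rangle$ (linear in the second variable) that admits at least one decomposition $K=K_+\oplus K_-$ into orthogonal subspaces such that $K_+$ is a Hilbert space with the restricted form and $K_-$ is a Hilbert space with the opposite of the restricted form. The operator $J:x_++x_-\mapsto x_+-x_-$ is the associated fundamental symmetry of $K$, and $|K|_J:=K_+\oplus(-K_-)$ (where the sign of the form is reversed on $K_-$) is the associated Hilbert space. All the Hilbert norms so obtained are equivalent and define the topology of $K$. $\mathscr{B}(K)$ denotes the algebra of continuous linear operators on $K$, with involution $T\mapsto T^*$ the Kreĭn space adjoint, defined by $\langle T^*x\mid y\rangle=\langle x\mid Ty\rangle$ for all $x,y\in K$. Its topology is that of the (mutually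 equivalent) operator norms determined by the Hilbert spaces $|K|_J$, and ''closed'' refers to this topology. $\mathscr{B}(K)$ is a Kreĭn C*-algebra, with fundamental symmetries $T\mapsto JTJ$. A representation of $\mathscr{A}$ on $K$ is a unital $*$-homomorphism $\mathscr{A}\to\mathscr{B}(K)$; it is faithful if it is injective. *)

(* Defs.v *)
From HB Require Import structures.
From mathcomp Require Import all_boot all_order all_algebra.
From mathcomp Require Import complex.
From mathcomp Require Import all_classical all_reals all_analysis.

Set Implicit Arguments.
Unset Strict Implicit.
Unset Printing Implicit Defensive.

Import Order.TTheory GRing.Theory Num.Theory.
Import numFieldNormedType.Exports.

Local Open Scope classical_set_scope.
Local Open Scope ring_scope.
Local Open Scope complex_scope.

Section Completeness.
Context (R : realType) (V : zmodType) (N : V -> R).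

Definition cauchy_sequence (u : nat -> V) : Prop :=
  forall e : R, 0 < e -> exists n0 : nat, forall m n : nat,
    (n0 <= m)%N -> (n0 <= n)%N -> N (u m - u n) < e.

Definition converges_to (u : nat -> V) (l : V) : Prop :=
  N (u n - l) @[n --> \oo] --> (0 : R).

Definition complete_on (S : {pred V}) : Prop :=
  forall u : nat -> V, (forall n, u n \in S) -> cauchy_sequence u ->
  exists2 l, l \in S & converges_to u l.

End Completeness.

(* MathComp's [algType] builds on [nzRingType] and hence excludes the zero
   algebra, which is a unital Krein C*-algebra; and the hierarchy admits no join
   of [lmodType] and [pzRingType] that [algType] does not already inherit from.
   The product of a possibly zero unital algebra is thus added to [lmodType]. *)
HB.mixin Record hasUnitalProduct (F : pzRingType) A & GRing.Lmodule F A := {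
  aone : A;
  amul : A -> A -> A;
  amulA : associative amul;
  amul1l : left_id aone amul;
  amul1r : right_id aone amul;
  amul_linearl : forall y : A, linear (amul^~ y);
  amul_linearr : forall x : A, linear (amul x)
}.

#[short(type="unitalAlgType")]
HB.structure Definition UnitalAlgebra (F : pzRingType) :=
  {A of GRing.Lmodule F A & hasUnitalProduct F A}.

HB.mixin Record hasInvolution (R : realType) A & UnitalAlgebra R[i] A := {
  star : A -> A;
  star_antilinear : forall (a : R[i]) (x y : A),
    star (a *: x + y) = a^*%C *: star x + star y;
  starK : involutive star;
  starM : forall x y : A, star (amul x y) = amul (star y) (star x)
}.

#[short(type="starAlgType")]
HB.structure Definition StarAlgebra (R : realType) :=
  {A of UnitalAlgebra R[i] A & hasInvolution R A}.

Section KreinCStar.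
Context (R : realType) (A : starAlgType R).

Definition banach_algebra_norm (N : A -> R) : Prop :=
  [/\ (forall x, 0 <= N x) /\ (forall x, N x = 0 -> x = 0),
      forall x y, N (x + y) <= N x + N y,
      forall (a : R[i]) x, N (a *: x) = complex.Re `|a| * N x,
      forall x y, N (amul x y) <= N x * N y
    & complete_on N predT].

(* Bijectivity and unitality are implied by [involutive alpha]. *)
Definition involutive_star_automorphism (alpha : A -> A) : Prop :=
  [/\ linear alpha,
      {morph alpha : x y / amul x y},
      {morph alpha : x / star x}
    & involutive alpha].

Definition krein_cstar_axiom : Prop :=
  exists (N : A -> R) (alpha : A -> A),
    [/\ banach_algebra_norm N,
        involutive_star_automorphism alpha
      & forall x, N (amul (alpha (star x)) x) = N x ^+ 2].

End KreinCStar.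

HB.mixin Record isKreinCStarAlgebra (R : realType) A & StarAlgebra R A := {
  krein_cstarP : krein_cstar_axiom A
}.

#[short(type="kreinCStarAlgType")]
HB.structure Definition KreinCStarAlgebra (R : realType) :=
  {A of StarAlgebra R A & isKreinCStarAlgebra R A}.

HB.mixin Record hasHermitianForm (R : realType) K & GRing.Lmodule R[i] K := {
  kform : K -> K -> R[i];
  kform_linear : forall x : K, scalar (kform x);
  kform_herm : forall x y : K, kform y x = (kform x y)^*%C
}.

#[short(type="hermitianSpaceType")]
HB.structure Definition HermitianSpace (R : realType) :=
  {K of GRing.Lmodule R[i] K & hasHermitianForm R K}.

Section Decomposition.
Context (R : realType) (K : hermitianSpaceType R).

(* The order on [R[i]] makes [0 < g x x] include that [g x x] is real. *)
Definition hilbert_subspace (g : K -> K -> R[i]) (S : {pred K}) : Prop :=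
  [/\ submod_closed S,
      forall x, x \in S -> x != 0 -> 0 < g x x
    & complete_on (fun x => Num.sqrt (complex.Re (g x x))) S].

Definition fundamental_decomposition (Kp Km : {pred K}) : Prop :=
  [/\ hilbert_subspace kform Kp,
      hilbert_subspace (fun x y => - kform x y) Km,
      {in Kp & Km, forall x y, kform x y = 0},
      forall x, x \in Kp -> x \in Km -> x = 0
    & forall z, exists x y, [/\ x \in Kp, y \in Km & z = x + y]].

End Decomposition.

HB.mixin Record isKreinSpace (R : realType) K & HermitianSpace R K := {
  krein_decompositionP :
    exists Kp Km : {pred K}, fundamental_decomposition Kp Km
}.

#[short(type="kreinSpaceType")]
HB.structure Definition KreinSpace (R : realType) :=
  {K of HermitianSpace R K & isKreinSpace R K}.

Section Operators.
Context (R : realType) (K : kreinSpaceType R).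
Implicit Types (J T : K -> K) (S : set (K -> K)).

Definition fundamental_symmetry J : Prop :=
  exists Kp Km : {pred K}, fundamental_decomposition Kp Km /\
    {in Kp & Km, forall x y, J (x + y) = x - y}.

(* Norm of the Hilbert space |K|_J: by orthogonality, reversing the sign of the
   form on K_- turns <x|y> into <x|J y>. *)
Definition hnorm J (x : K) : R := Num.sqrt (complex.Re (kform x (J x))).

(* The norms [hnorm J] are mutually equivalent, so quantifying over all [J] or
   fixing one [J] gives the same continuous operators, and likewise the same
   closed sets of operators below. *)
Definition krein_continuous T : Prop :=
  forall J, fundamental_symmetry J ->
  forall (x : K) (e : R), 0 < e -> exists2 d : R, 0 < d &
    forall y, hnorm J (y - x) < d -> hnorm J (T y - T x) < e.

Definition cont_linear_operators : set (K -> K) :=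
  [set T | linear T /\ krein_continuous T].

Definition opnorm J T : R :=
  sup [set hnorm J (T x) | x in [set x | hnorm J x <= 1]].

Definition closed_operator_set S : Prop :=
  forall J, fundamental_symmetry J ->
  forall T, cont_linear_operators T ->
    (forall e : R, 0 < e -> exists2 T', S T' & opnorm J (T - T') < e) -> S T.

(* Adjoints of continuous operators exist (Riesz) and are unique, the form being
   nondegenerate. *)
Definition is_krein_adjoint T T' : Prop :=
  forall x y : K, kform (T' x) y = kform x (T y).

Definition closed_unital_star_subalgebra S : Prop :=
  [/\ S `<=` cont_linear_operators,
      S id,
      (forall (a : R[i]) T T', S T -> S T' -> S (a *: T + T')) /\
        (forall T T', S T -> S T' -> S (T \o T')),
      forall T, S T -> exists2 T', S T' & is_krein_adjoint T T'
    & closed_operator_set S].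

End Operators.

Arguments cont_linear_operators {R} K.

Section Representations.
Context (R : realType) (A : starAlgType R) (K : kreinSpaceType R).

Definition representation (pi : A -> (K -> K)) : Prop :=
  [/\ forall x, cont_linear_operators K (pi x),
      linear pi,
      pi aone = id,
      {morph pi : x y / amul x y >-> x \o y}
    & forall x, is_krein_adjoint (pi x) (pi (star x))].

End Representations.

(* Main.v *)
(* If [alpha] is a fundamental symmetry of [A], then [x |-> alpha (star x)] is a
   second involution, for which [A] is a C*-algebra; Gelfand--Naimark gives a
   Hilbert space [H] and an isometric representation [rho] of it. On [H * H],
   with the Krein form [<(u, v) | (u', v')> = <u | v'> + <v | u'>], the operators
   [pi x = (rho x, rho (alpha x))] satisfy [<pi (star x) p | q> = <p | pi x q>].
   The range of [pi] is closed since [rho] is isometric and all Hilbert norms of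
   a Krein space are equivalent (uniform boundedness).

   Gelfand--Naimark is proved without spectral theory. Square roots of [1 - u],
   [N u <= 1], come from the iteration [z |-> (u + z^2) / 2], dominated by its
   scalar counterpart; for selfadjoint [h] of norm at most [1], being a square is
   then equivalent to [N (1 - h) <= 1], so that squares form a cone. *)

(* The form on [H * H] pairs the two components crosswise because [rho] represents [A] with the
   involution [x |-> alpha (star x)]: the Hilbert adjoint of [rho (alpha x)] is [rho (star x)], so
   the operator that [star x] needs in one component is the adjoint of what [pi x] has in the other.
   The second component makes the norm of [pi x] depend on [rho (alpha x)]. Since [alpha] is not
   assumed continuous, that it does not increase the norm is itself derived from positivity. The
   norm is not assumed to be normalised either: the C*-identity forces [N aone] to be [1] or [0],
   the latter only in the zero algebra, which needs its own case in the construction of states. The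
   main obstacle is positivity of [star x ** x]. The classical argument compares the spectra of
   [x y] and [y x]; here products are chosen whose negatives are visibly squares. Equivalence of the
   Hilbert norms cannot be avoided: closedness and continuity are demanded for every fundamental
   symmetry, whereas the norm of [pi x] is only known for the swap. *)
From HB Require Import structures.
Require Import Defs.
From mathcomp Require Import all_boot all_order all_algebra.
From mathcomp Require Import complex.
From mathcomp Require Import all_classical all_reals all_analysis.
From mathcomp Require Import ring lra.

Set Implicit Arguments.
Unset Strict Implicit.
Unset Printing Implicit Defensive.

Import Order.TTheory GRing.Theory Num.Theory.
Import numFieldNormedType.Exports.

Local Open Scope classical_set_scope.
Local Open Scope ring_scope.

(** * Linear identities in modules *)

Section ModuleReflection.
Context (F : pzRingType) (V : lmodType F).

Inductive lexpr :=
  | LVar of nat | LZero | LAdd of lexpr & lexpr | LOpp of lexpr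
  | LScale of F & lexpr.

Fixpoint leval (env : seq V) (e : lexpr) : V :=
  match e with
  | LVar n => nth 0 env n
  | LZero => 0
  | LAdd e1 e2 => leval env e1 + leval env e2
  | LOpp e1 => - leval env e1
  | LScale c e1 => c *: leval env e1
  end.

Fixpoint lcoef (e : lexpr) (i : nat) : F :=
  match e with
  | LVar n => if n == i then 1 else 0
  | LZero => 0
  | LAdd e1 e2 => lcoef e1 i + lcoef e2 i
  | LOpp e1 => - lcoef e1 i
  | LScale c e1 => c * lcoef e1 i
  end.

Lemma levalE env e : leval env e = \sum_(i < size env) lcoef e i *: env`_i.
Proof.
elim: e => [n||e1 ih1 e2 ih2|e1 ih1|c e1 ih1] /=; rewrite ?ih1 ?ih2.
- have [nenv|nenv] := ltnP n (size env).
    rewrite (bigD1 (Ordinal nenv))//= eqxx scale1r big1 ?addr0// => i.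
    by rewrite -val_eqE/= eq_sym => /negPf->; rewrite scale0r.
  rewrite nth_default// big1// => i _; case: eqVneq => [ni|]; last by rewrite scale0r.
  by have := ltn_ord i; rewrite -ni ltnNge nenv.
- by rewrite big1// => i _; rewrite scale0r.
- by rewrite -big_split/=; apply: eq_bigr => i _; rewrite scalerDl.
- by rewrite -sumrN; apply: eq_bigr => i _; rewrite scaleNr.
- by rewrite scaler_sumr; apply: eq_bigr => i _; rewrite scalerA.
Qed.

(** An iterated conjunction rather than a quantification over indices, so that [cbn] leaves one
    scalar identity per atom for [ring] or [field]. *)
Fixpoint lcoef_eq (e1 e2 : lexpr) (n : nat) : Prop :=
  if n is m.+1 then lcoef e1 m = lcoef e2 m /\ lcoef_eq e1 e2 m else True.

Lemma leval_eq env e1 e2 : lcoef_eq e1 e2 (size env) ->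
  leval env e1 = leval env e2.
Proof.
move=> h; rewrite !levalE; apply: eq_bigr => -[i /= ilt] _; congr (_ *: _).
elim: (size env) h ilt => //= n ih [e12 /ih {}ih].
by rewrite ltnS leq_eqVlt => /orP[/eqP->|].
Qed.

End ModuleReflection.

(** Atoms are compared by [unify], not syntactically; the dummy match on [I] runs this tactic while
    a term is being built. *)
Ltac lindex x env :=
  lazymatch env with
  | ?y :: ?env' =>
      match constr:(I) with
      | _ => let _ := match constr:(I) with _ => unify x y end in constr:(0%N)
      | _ => let n := lindex x env' in constr:(S n)
      end
  end.

Ltac latoms env t :=
  lazymatch t with
  | @GRing.zero _ => env
  | GRing.add ?a ?b => let env' := latoms env a in latoms env' b
  | GRing.opp ?a => latoms env a
  | GRing.scale _ ?a => latoms env a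
  | ?a =>
      let rec mem e := lazymatch e with
        | ?b :: ?e' =>
            match constr:(I) with
            | _ => let _ := match constr:(I) with _ => unify a b end in env
            | _ => mem e'
            end
        | _ => constr:(a :: env) end in
      mem env
  end.

Ltac lreify F env t :=
  lazymatch t with
  | @GRing.zero _ => constr:(@LZero F)
  | GRing.add ?a ?b =>
      let a' := lreify F env a in let b' := lreify F env b in
      constr:(LAdd a' b')
  | GRing.opp ?a => let a' := lreify F env a in constr:(LOpp a')
  | GRing.scale ?c ?a =>
      let a' := lreify F env a in constr:(@LScale F c a')
  | ?a => let n := lindex a env in constr:(@LVar F n)
  end.

(* Reduces a linear identity in the [F]-module [V] to the equality of the
   coefficients of each atom. *)
Ltac module F V :=
  lazymatch goal with
  | |- @eq _ ?l ?r =>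
      let env := latoms (@nil V) l in
      let env := latoms env r in
      let l' := lreify F env l in
      let r' := lreify F env r in
      apply: (@leval_eq F V env l' r'); cbn [lcoef_eq lcoef size eq_op];
      repeat (split; first by [ring|field]); try exact: I
  end.

(** * C*-algebras *)

Section Convergence.
Context (R : realType) (V : zmodType) (N : V -> R).

Lemma converges_toP (N_ge0 : forall x, 0 <= N x) (u : nat -> V) l :
  converges_to N u l <->
  forall e : R, 0 < e -> exists n0, forall n, (n0 <= n)%N -> N (u n - l) < e.
Proof.
split=> [/cvgrPdist_lt h e /h [n0 _ hn]|h].
  by exists n0 => n /hn /=; rewrite sub0r normrN ger0_norm.
apply/cvgrPdist_lt => e /h[n0 hn]; exists n0 => // n /hn /=.
by rewrite sub0r normrN ger0_norm.
Qed.

End Convergence.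

(** The restriction to [e <= 1] allows estimates that are quadratic in [e] to be replaced by linear
    ones. *)
Lemma le0_of_le_eps (R : realType) (x C : R) :
  (forall e, 0 < e -> e <= 1 -> x <= C * e) -> x <= 0.
Proof.
move=> h; rewrite leNgt; apply/negP => x0.
have C0 : 0 < `|C| + x + 1 by rewrite ltr_wpDl// addr_ge0// ltW.
(* In the denominator, [|C|] makes [C * e] smaller than [x], and [x] makes [e] at most [1]. *)
pose e := x / (`|C| + x + 1) / 2.
have e0 : 0 < e by rewrite !divr_gt0.
have eE : e * (`|C| + x + 1) * 2 = x by rewrite /e; field; rewrite gt_eqF.
have e1 : e <= 1.
  by rewrite /e -mulrA -invfM ler_pdivrMr ?mulr_gt0//; have := normr_ge0 C; lra.
have := h e e0 e1; have := ler_wpM2r (ltW e0) (ler_norm C).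
by have := mulr_gt0 e0 x0; nra.
Qed.

Section StarAlgebraTheory.
Context (R : realType) (A : starAlgType R).
Local Open Scope complex_scope.
Local Notation "x ** y" := (amul x y) (at level 40, left associativity).
Implicit Types (x y z : A) (a : R[i]).

Lemma amulDl x y z : (x + y) ** z = x ** z + y ** z.
Proof. by have := amul_linearl z 1 x y; rewrite !scale1r. Qed.

Lemma amulDr x y z : x ** (y + z) = x ** y + x ** z.
Proof. by have := amul_linearr x 1 y z; rewrite !scale1r. Qed.

Lemma amul0l x : 0 ** x = 0.
Proof. by apply: (addIr (0 ** x)); rewrite -amulDl !add0r. Qed.

Lemma amul0r x : x ** 0 = 0.
Proof. by apply: (addIr (x ** 0)); rewrite -amulDr !add0r. Qed.

Lemma amulZl a x y : (a *: x) ** y = a *: (x ** y).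
Proof. by have := amul_linearl y a x 0; rewrite amul0l !addr0. Qed.

Lemma amulZr a x y : x ** (a *: y) = a *: (x ** y).
Proof. by have := amul_linearr x a y 0; rewrite amul0r !addr0. Qed.

Lemma amulNl x y : (- x) ** y = - (x ** y).
Proof. by rewrite -scaleN1r amulZl scaleN1r. Qed.

Lemma amulNr x y : x ** (- y) = - (x ** y).
Proof. by rewrite -scaleN1r amulZr scaleN1r. Qed.

Lemma amulBl x y z : (x - y) ** z = x ** z - y ** z.
Proof. by rewrite amulDl amulNl. Qed.

Lemma amulBr x y z : x ** (y - z) = x ** y - x ** z.
Proof. by rewrite amulDr amulNr. Qed.

Lemma starD x y : star (x + y) = star x + star y.
Proof. by have := star_antilinear 1 x y; rewrite !(conjc1, scale1r). Qed.

Lemma star0 : star (0 : A) = 0.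
Proof. by apply: (addIr (star 0)); rewrite -starD !add0r. Qed.

Lemma starZ a x : star (a *: x) = a^*%C *: star x.
Proof. by have := star_antilinear a x 0; rewrite star0 !addr0. Qed.

Lemma starZr (r : R) x : star (r%:C *: x) = r%:C *: star x.
Proof. by rewrite starZ conjc_real. Qed.

Lemma starN x : star (- x) = - star x.
Proof. by rewrite -scaleN1r starZ rmorphN1 scaleN1r. Qed.

Lemma starB x y : star (x - y) = star x - star y.
Proof. by rewrite starD starN. Qed.

Lemma star1 : star (aone : A) = aone.
Proof. by rewrite -[LHS]amul1r -{2}[aone]starK -starM amul1r starK. Qed.

Section BanachNorm.
Context (N : A -> R) (HN : banach_algebra_norm N).

Lemma bnorm_ge0 x : 0 <= N x.
Proof. by case: HN => [[]]. Qed.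

Lemma bnorm_eq0 x : N x = 0 -> x = 0.
Proof. by case: HN => [[_ +]] _ _ _ _; exact. Qed.

Lemma bnormD x y : N (x + y) <= N x + N y.
Proof. by case: HN => _ + _ _ _; exact. Qed.

Lemma bnormM x y : N (x ** y) <= N x * N y.
Proof. by case: HN => _ _ _ + _; exact. Qed.

Lemma bnormZ a x : N (a *: x) = complex.Re `|a| * N x.
Proof. by case: HN => _ _ + _ _; exact. Qed.

Lemma bnormZr (r : R) x : N (r%:C *: x) = `|r| * N x.
Proof. by rewrite bnormZ normc_def/= expr0n/= addr0 sqrtr_sqr. Qed.

Lemma bnorm0 : N 0 = 0.
Proof. by rewrite -(scale0r 0) bnormZ normr0 mul0r. Qed.

Lemma bnormN x : N (- x) = N x.
Proof. by rewrite -scaleN1r bnormZ normrN1 mul1r. Qed.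

Lemma bnormB x y : N (x - y) <= N x + N y.
Proof. by rewrite (le_trans (bnormD _ _))// bnormN. Qed.

Lemma bnormBC x y : N (x - y) = N (y - x).
Proof. by rewrite -bnormN opprB. Qed.

Lemma eq0_of_bnorm_le_eps x C : (forall e, 0 < e -> N x <= C * e) -> x = 0.
Proof.
move=> h; have {}h := le0_of_le_eps (fun e e0 _ => h e e0); apply: bnorm_eq0.
by apply/eqP; rewrite eq_le h bnorm_ge0.
Qed.

(** A bounded additive map has a closed kernel. This carries commutation and selfadjointness from
    the iterates of the square root to their limit. *)
Lemma additive_lipschitz_lim (f : A -> A) (C : R) (u : nat -> A) l :
  (forall x y, f (x - y) = f x - f y) -> (forall x, N (f x) <= C * N x) ->
  converges_to N u l -> (forall n, f (u n) = 0) -> f l = 0.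
Proof.
move=> fB fC /(converges_toP bnorm_ge0) ul fu0.
apply: (@eq0_of_bnorm_le_eps _ `|C|) => e /ul[n /(_ _ (leqnn n)) h].
have -> : f l = - f (u n - l) by rewrite fB fu0 sub0r opprK.
rewrite bnormN (le_trans (fC _))// (le_trans (ler_norm _))// normrM.
by rewrite ler_wpM2l// ger0_norm ?bnorm_ge0// ltW.
Qed.

End BanachNorm.
End StarAlgebraTheory.

(** * Square roots of [aone - u] by iteration *)

Section SquareRootIteration.
Context (R : realType).

Fixpoint sqrt_majorant (n : nat) : R :=
  if n is m.+1 then (1 + sqrt_majorant m ^+ 2) / 2 else 0.

Lemma sqrt_majorant_itv n : 0 <= sqrt_majorant n <= 1.
Proof.
elim: n => [|n /andP[s0 s1]] /=; first by rewrite lexx ler01.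
have s2 : sqrt_majorant n ^+ 2 <= 1 by rewrite expr_le1.
by have := sqr_ge0 (sqrt_majorant n); move=> ?; apply/andP; split; lra.
Qed.

Lemma sqrt_majorant_homo m n : (m <= n)%N ->
  sqrt_majorant m <= sqrt_majorant n.
Proof.
move=> /subnK <-; elim: (n - m)%N => [//|k ih]; rewrite addSn /=.
by rewrite (le_trans ih)//; have := sqr_ge0 (1 - sqrt_majorant (k + m)); rewrite sqrrB expr1n mul1r; lra.
Qed.

(** The sequence tends to [1] only like [1 - 2/n], so no geometric estimate is available;
    monotonicity and boundedness suffice. *)
Lemma sqrt_majorant_cauchy (e : R) : 0 < e -> exists n0, forall m n,
  (n0 <= m)%N -> (n0 <= n)%N -> sqrt_majorant n - sqrt_majorant m < e.
Proof.
move=> e0; have hs : has_sup (range sqrt_majorant).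
  split; first by exists (sqrt_majorant 0), 0%N.
  by exists 1 => _ [n _ <-]; case/andP: (sqrt_majorant_itv n).
have [_ [n0 _ <-] hn0] := sup_adherent e0 hs.
exists n0 => m n /sqrt_majorant_homo n0m _.
have : sqrt_majorant n <= sup (range sqrt_majorant).
  by apply: sup_upper_bound => //; exists n.
by move: hn0 n0m; lra.
Qed.

End SquareRootIteration.

Section CStarAlgebra.
Context (R : realType) (A : starAlgType R) (N : A -> R).
Hypothesis HN : banach_algebra_norm N.
Hypothesis NC : forall x, N (amul (star x) x) = N x ^+ 2.
Local Open Scope complex_scope.
Local Notation "x ** y" := (amul x y) (at level 40, left associativity).
Implicit Types (x y z h k : A) (a : R[i]) (r t : R).

Definition selfadjoint x := star x = x.

Local Notation N_ge0 := (bnorm_ge0 HN).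

Lemma cnorm_star x : N (star x) = N x.
Proof.
have le_star y : N y <= N (star y).
  have [->|Ny] := eqVneq (N y) 0; first exact: N_ge0.
  have Ny0 : 0 < N y by rewrite lt_neqAle eq_sym Ny N_ge0.
  by rewrite -(ler_pM2r Ny0) -expr2 -NC (bnormM HN).
by apply/eqP; rewrite eq_le le_star -{2}[x]starK le_star.
Qed.

Lemma cnorm1_le1 : N aone <= 1.
Proof.
have := NC aone; rewrite star1 amul1l => h.
by rewrite leNgt; apply/negP => h1; move: h; nra.
Qed.

Lemma cnorm_selfadjoint x : selfadjoint x -> N (x ** x) = N x ^+ 2.
Proof. by move=> sx; rewrite -{1}sx NC. Qed.

Section SquareRoot.
Variables (u : A) (Nu : N u <= 1).

Fixpoint sqrt_iter (n : nat) : A :=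
  if n is m.+1 then (2^-1)%:C *: (u + sqrt_iter m ** sqrt_iter m) else 0.

Lemma sqrt_iter_le n : N (sqrt_iter n) <= sqrt_majorant R n.
Proof.
elim: n => [|n ih] /=; first by rewrite (bnorm0 HN).
rewrite (bnormZr HN) ger0_norm ?invr_ge0// mulrC ler_wpM2r ?invr_ge0//.
rewrite (le_trans (bnormD HN _ _))// lerD// (le_trans (bnormM HN _ _))//.
by rewrite expr2 ler_pM ?N_ge0.
Qed.

(** With [s] and [t] bounding [N x] and [N y], the splitting [x ** x - y ** y = x ** (x - y) + (x -
    y) ** y] gives at most [(s + t) * (s - t) = s ^+ 2 - t ^+ 2], which is the step of the scalar
    recursion. *)
Lemma sqrt_iterB (n j : nat) :
  N (sqrt_iter (j + n) - sqrt_iter n) <=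
  sqrt_majorant R (j + n) - sqrt_majorant R n.
Proof.
elim: n j => [|n ih] j; first by rewrite addn0 !subr0 sqrt_iter_le.
rewrite addnS /= -scalerBr opprD addrACA subrr add0r.
set x := sqrt_iter (j + n); set y := sqrt_iter n.
have -> : x ** x - y ** y = x ** (x - y) + (x - y) ** y.
  by rewrite amulBr amulBl addrA subrK.
rewrite (bnormZr HN) ger0_norm ?invr_ge0//.
have := ih j; rewrite -/x -/y => hxy.
have hx : N x <= sqrt_majorant R (j + n) by exact: sqrt_iter_le.
have hy : N y <= sqrt_majorant R n by exact: sqrt_iter_le.
have h1 := le_trans (bnormM HN x (x - y)) (ler_pM (N_ge0 _) (N_ge0 _) hx hxy).
have h2 := le_trans (bnormM HN (x - y) y) (ler_pM (N_ge0 _) (N_ge0 _) hxy hy).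
have h3 := le_trans (bnormD HN (x ** (x - y)) ((x - y) ** y)) (lerD h1 h2).
rewrite mulrC ler_pdivrMr// (le_trans h3)// le_eqVlt; apply/orP; left.
by apply/eqP; field.
Qed.

Lemma sqrt_iter_cvg : exists l, converges_to N sqrt_iter l.
Proof.
have [_ _ _ _ cA] := HN.
have [|l _ hl] := cA sqrt_iter (fun=> isT); last by exists l.
move=> e /sqrt_majorant_cauchy[n0 hn0].
have hle m n : (m <= n)%N -> (n0 <= m)%N -> N (sqrt_iter n - sqrt_iter m) < e.
  move=> mn n0m; have n0n := leq_trans n0m mn.
  rewrite -(subnK mn) (le_lt_trans (sqrt_iterB _ _))// subnK//.
  exact: hn0.
exists n0 => m n n0m n0n; have [mn|/ltnW nm] := leqP m n; last exact: hle.
by rewrite (bnormBC HN) hle.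
Qed.

(** The limit [l] of the iteration satisfies [l + l = u + l ** l], so [k = aone - l] has square
    [aone - u]. The iterates are polynomials in [u] with real coefficients, whence selfadjointness
    and commutation. *)
Lemma sqrt_sub1 : selfadjoint u ->
  exists k, [/\ selfadjoint k, k ** k = aone - u, N (aone - k) <= 1 &
                forall w, w ** u = u ** w -> w ** k = k ** w].
Proof.
move=> su; have [l hl] := sqrt_iter_cvg.
have comm w : w ** u = u ** w -> w ** l = l ** w.
  move=> wu; apply/eqP; rewrite -subr_eq0; apply/eqP.
  apply: (@additive_lipschitz_lim _ _ _ HN (fun x => w ** x - x ** w)
    (2 * N w) _ _ _ _ hl) => [x y|x|n].
  - by rewrite amulBr amulBl; module R[i] A.
  - rewrite (le_trans (bnormB HN _ _))// mulr_natl mulrDl.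
    by rewrite lerD// ?(bnormM HN)// mulrC (bnormM HN).
  - apply/eqP; rewrite subr_eq0; apply/eqP.
    elim: n => [|n ih]/=; first by rewrite amul0l amul0r.
    by rewrite amulZr amulZl amulDr amulDl amulA ih -!amulA ih wu.
have sl : selfadjoint l.
  apply/eqP; rewrite -subr_eq0; apply/eqP.
  apply: (@additive_lipschitz_lim _ _ _ HN (fun x => star x - x) 2
    _ _ _ _ hl) => [x y|x|n].
  - by rewrite starB; module R[i] A.
  - by rewrite (le_trans (bnormB HN _ _))// cnorm_star mulr_natl.
  - apply/eqP; rewrite subr_eq0; apply/eqP.
    elim: n => [|n ih]/=; first by rewrite star0.
    by rewrite starZr starD su starM ih.
have Nl : N l <= 1.
  apply/ler_addgt0Pr => e e0.
  have /(converges_toP N_ge0) /(_ _ e0)[n /(_ _ (leqnn n)) hn] := hl.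
  have -> : l = sqrt_iter n - (sqrt_iter n - l) by rewrite subKr.
  rewrite (le_trans (bnormB HN _ _))// lerD// ?(ltW hn)//.
  by rewrite (le_trans (sqrt_iter_le n))//; case/andP: (sqrt_majorant_itv R n).
(* Eliminating [u] through [y + y = u + x ** x] expresses the defect by the errors of two
   consecutive iterates: [y - l] twice, [x - l] times [x] and [l] times [x - l]. This is where
   [3 + N l] comes from. *)
have lE : l + l = u + l ** l.
  apply/eqP; rewrite -subr_eq0; apply/eqP.
  apply: (@eq0_of_bnorm_le_eps _ _ _ HN _ (3 + N l)) => e e0.
  have /(converges_toP N_ge0) /(_ _ e0)[n hn] := hl.
  set x := sqrt_iter n; set y := sqrt_iter n.+1.
  have hx : N (x - l) <= e by rewrite ltW ?hn.
  have hy : N (y - l) <= e by rewrite ltW ?hn.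
  have x1 : N x <= 1.
    by rewrite (le_trans (sqrt_iter_le n))//; case/andP: (sqrt_majorant_itv R n).
  have yE : y + y = u + x ** x.
    by rewrite /y -[sqrt_iter n.+1]/((2^-1)%:C *: (u + x ** x)); module R[i] A.
  have -> : l + l - (u + l ** l) =
      - (y - l) - (y - l) + ((x - l) ** x + l ** (x - l)).
    have -> : u = y + y - x ** x by rewrite yE addrK.
    by rewrite amulBl amulBr; module R[i] A.
  have h1 := bnormM HN (x - l) x; have h2 := bnormM HN l (x - l).
  have h3 := bnormD HN ((x - l) ** x) (l ** (x - l)).
  have h4 := bnormB HN (- (y - l)) (y - l).
  have := bnormD HN (- (y - l) - (y - l)) ((x - l) ** x + l ** (x - l)).
  rewrite (bnormN HN) in h4.
  have h5 : N (x - l) * N x <= e * 1 by rewrite ler_pM ?N_ge0.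
  have h6 : N l * N (x - l) <= N l * e by rewrite ler_wpM2l ?N_ge0.
  by rewrite mulrDl => h7; lra.
exists (aone - l); split.
- by rewrite /selfadjoint starB star1 sl.
- have -> : u = l + l - l ** l by rewrite lE addrK.
  by rewrite amulBl !amulBr !amul1l !amul1r; module R[i] A.
- by rewrite opprB addrC subrK.
- by move=> w wu; rewrite amulBr amulBl amul1r amul1l comm.
Qed.

End SquareRoot.
End CStarAlgebra.

(** * Positive elements and the positivity of [star x ** x] *)

Section Positivity.
Context (R : realType) (A : starAlgType R) (N : A -> R).
Hypothesis HN : banach_algebra_norm N.
Hypothesis NC : forall x, N (amul (star x) x) = N x ^+ 2.
Local Open Scope complex_scope.
Local Notation "x ** y" := (amul x y) (at level 40, left associativity).
Implicit Types (x y z h k : A) (a : R[i]) (r t : R).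

Local Notation N_ge0 := (bnorm_ge0 HN).
Local Notation sa := (@selfadjoint R A).

(** Replaces the condition of a nonnegative spectrum. That every [star x ** x] has this form is the
    goal of the section, [positive_starM]. *)
Definition positive h := exists2 k, sa k & h = k ** k.

Lemma positive_ext x y : x = y -> positive y -> positive x.
Proof. by move->. Qed.

Lemma positive_sa h : positive h -> sa h.
Proof. by case=> k sk ->; rewrite /selfadjoint starM sk. Qed.

Lemma selfadjointD x y : sa x -> sa y -> sa (x + y).
Proof. by rewrite /selfadjoint starD => -> ->. Qed.

Lemma selfadjointB x y : sa x -> sa y -> sa (x - y).
Proof. by rewrite /selfadjoint starB => -> ->. Qed.

Lemma selfadjointZ r x : sa x -> sa (r%:C *: x).
Proof. by rewrite /selfadjoint starZr => ->. Qed.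

Lemma selfadjoint1 : sa aone.
Proof. exact: star1. Qed.

Lemma selfadjoint_starM x : sa (star x ** x).
Proof. by rewrite /selfadjoint starM starK. Qed.

Lemma positive_scale r h : 0 <= r -> positive h -> positive (r%:C *: h).
Proof.
move=> r0 [k sk ->]; exists ((Num.sqrt r)%:C *: k); first exact: selfadjointZ.
by rewrite amulZl amulZr scalerA -rmorphM -expr2 sqr_sqrtr.
Qed.

(* [w = k + i s] is unitary, and [2 i s = w - w^*]. *)
Lemma cnorm_le1_of_sqr_sum k s : sa k -> sa s -> k ** s = s ** k ->
  k ** k + s ** s = aone -> N s <= 1.
Proof.
move=> sk ss ks ks1; pose w := k + 'i *: s.
have swE : star w = k - 'i *: s.
  rewrite /w starD starZ sk ss; congr (_ + _).
  by rewrite -scaleNr; congr (_ *: _); apply/eqP; rewrite eq_complex/= oppr0 !eqxx.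
have : N w ^+ 2 <= 1.
  rewrite -NC swE /w amulBl !amulDr !(amulZl, amulZr) ks scalerA -expr2 sqr_i.
  have -> : k ** k + 'i *: (s ** k) - ('i *: (s ** k) + -1 *: (s ** s)) =
    k ** k + s ** s by module R[i] A.
  by rewrite ks1 (cnorm1_le1 NC).
rewrite expr_le1 ?N_ge0// => w1.
have w1' : N (star w) <= 1 by rewrite (cnorm_star HN NC).
have : N (w - star w) <= 1 + 1 by rewrite (le_trans (bnormB HN _ _))// lerD.
rewrite swE /w.
have -> : k + 'i *: s - (k - 'i *: s) = 'i *: (2%:R%:C *: s) by module R[i] A.
rewrite (bnormZ HN) (bnormZr HN) normc_def/= expr0n expr1n/= add0r sqrtr1 mul1r.
by rewrite ger0_norm//; lra.
Qed.

(** Take [u = aone - h] in [sqrt_sub1]. The bound on [aone - k] allows a second application, to [k],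
    which is how the root in [positive_sqrt] becomes positive. *)
Lemma positive_of_norm_le1 h : sa h -> N (aone - h) <= 1 ->
  exists k, [/\ sa k, h = k ** k, N (aone - k) <= 1 &
    forall w, w ** h = h ** w -> w ** k = k ** w].
Proof.
move=> sh /(sqrt_sub1 HN NC)[|k [sk kE k1 kC]].
  exact: selfadjointB selfadjoint1 sh.
exists k; split=> //; first by rewrite kE; module R[i] A.
by move=> w wh; apply: kC; rewrite amulBr amulBl amul1l amul1r wh.
Qed.

(** If [h = k ** k], the root [s] of [aone - h] commutes with [k] and [k ** k + s ** s = aone];
    hence [N s <= 1], and [N (aone - h)] is the square of [N s]. *)
Lemma norm_1sub_le1 h : positive h -> N h <= 1 -> N (aone - h) <= 1.
Proof.
move=> [k sk ->] Nk; have [s [ss sE _ sC]] := sqrt_sub1 HN NC Nk (positive_sa (ex_intro2 _ _ k sk erefl)).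
rewrite -sE (cnorm_selfadjoint NC)// expr_le1 ?N_ge0//.
apply: (@cnorm_le1_of_sqr_sum k) => //; last by rewrite sE; module R[i] A.
by apply: sC; rewrite amulA.
Qed.

Lemma positive_rescale r h : 0 < r -> positive h -> N h <= r ->
  N (aone - (r^-1)%:C *: h) <= 1.
Proof.
move=> r0 ph hr; apply: norm_1sub_le1.
  by apply: positive_scale => //; rewrite invr_ge0 ltW.
by rewrite (bnormZr HN) ger0_norm ?invr_ge0 ?(ltW r0)// ler_pdivrMl// mulr1.
Qed.

Lemma rescaleK r h : 0 < r -> r%:C *: ((r^-1)%:C *: h) = h.
Proof. by move=> r0; rewrite scalerA -rmorphM mulfV ?gt_eqF// scale1r. Qed.

Lemma positive_sqrt h : positive h ->
  exists k, [/\ positive k, h = k ** k &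
    forall w, w ** h = h ** w -> w ** k = k ** w].
Proof.
(* The summand [1] keeps [r] invertible when [h] vanishes. *)
move=> ph; pose r := N h + 1.
have r0 : 0 < r by rewrite ltr_wpDl ?N_ge0.
have hr : N h <= r by rewrite lerDl.
have [|k [sk kE k1 kC]] := positive_of_norm_le1 _ (positive_rescale r0 ph hr).
  by apply: selfadjointZ; exact: positive_sa.
have [l [sl lE _ _]] := positive_of_norm_le1 sk k1.
exists ((Num.sqrt r)%:C *: k); split.
- by apply: positive_scale; [exact: sqrtr_ge0|exists l].
- by rewrite amulZl amulZr scalerA -rmorphM -expr2 sqr_sqrtr ?ltW// -kE rescaleK.
- move=> w wh; rewrite amulZl amulZr kC//.
  by rewrite amulZl amulZr wh.
Qed.

(** Divided by a common [r], both elements lie in the unit ball about [aone]. The ball is convex, so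
    it contains their midpoint, which is therefore a square. *)
Lemma positiveD h1 h2 : positive h1 -> positive h2 -> positive (h1 + h2).
Proof.
move=> p1 p2; pose r := N h1 + N h2 + 1.
have n1 := N_ge0 h1; have n2 := N_ge0 h2.
have r0 : 0 < r by rewrite /r; lra.
have r1 : N h1 <= r by rewrite /r; lra.
have r2 : N h2 <= r by rewrite /r; lra.
have {}r1 := positive_rescale r0 p1 r1.
have {}r2 := positive_rescale r0 p2 r2.
have s12 := selfadjointD (positive_sa p1) (positive_sa p2).
have [||k [sk kE _ _]] := @positive_of_norm_le1 ((2^-1)%:C *: ((r^-1)%:C *: (h1 + h2))).
- by do 2!apply: selfadjointZ.
- have -> : aone - (2^-1)%:C *: ((r^-1)%:C *: (h1 + h2)) =
    (2^-1)%:C *: ((aone - (r^-1)%:C *: h1) + (aone - (r^-1)%:C *: h2)).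
    by move: (r^-1)%:C => c; module R[i] A.
  rewrite (bnormZr HN) ger0_norm ?invr_ge0// ler_pdivrMl// mulr1.
  by rewrite (le_trans (bnormD HN _ _))// lerD.
have -> : h1 + h2 = r%:C *: (2%:C *: (k ** k)).
  by rewrite -kE [2%:C *: _]rescaleK ?rescaleK.
by do 2!(apply: positive_scale; rewrite ?ler0n ?ltW//); exists k.
Qed.

(** After division by [N h], the element lies at distance at most [1] from [aone]. *)
Lemma positive_norm_sub h : sa h -> positive ((N h)%:C *: aone - h).
Proof.
move=> sh; have [Nh|Nh] := eqVneq (N h) 0.
  have -> : h = 0 by exact: (bnorm_eq0 HN).
  by rewrite (bnorm0 HN) scale0r subr0; exists 0; rewrite /selfadjoint ?star0 ?amul0l.
have Nh0 : 0 < N h by rewrite lt_neqAle eq_sym Nh N_ge0.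
have [||k [sk kE _ _]] := @positive_of_norm_le1 (aone - ((N h)^-1)%:C *: h).
- by apply: selfadjointB; [exact: selfadjoint1|exact: selfadjointZ].
- rewrite opprB addrC subrK (bnormZr HN) ger0_norm ?invr_ge0 ?N_ge0//.
  by rewrite mulVf.
rewrite -[X in _ - X](rescaleK _ Nh0) -scalerBr kE.
by apply: positive_scale; [exact: N_ge0|exists k].
Qed.

Lemma positive1 : positive aone.
Proof. by exists aone; [exact: selfadjoint1|rewrite amul1l]. Qed.

(** For [t > 0], write [h / t = l ** l] and [aone - h / t = k ** k] with [k] commuting with [l];
    then [N l <= 1]. The case [t = 0] is reached from [t + e], and yields that the cone of squares
    is proper. *)
Lemma positive_norm_le t h : 0 <= t -> positive h ->
  positive (t%:C *: aone - h) -> N h <= t.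
Proof.
suff main r : 0 < r -> positive h -> positive (r%:C *: aone - h) -> N h <= r.
  move=> t0 ph pt; apply/ler_addgt0Pr.
  suff eps (e : R) : 0 < e -> N h <= t + e by exact: eps.
  move=> e0; apply: main => //; first by rewrite ltr_wpDl.
  have -> : (t + e)%:C *: aone - h = (t%:C *: aone - h) + e%:C *: aone.
    by module R[i] A.
  by apply: positiveD => //; apply: positive_scale; [exact: ltW|exact: positive1].
move=> r0 ph pr.
have r0' : 0 <= r^-1 by rewrite invr_ge0 ltW.
have [l sl lE] := positive_scale r0' ph.
have : positive (aone - (r^-1)%:C *: h).
  have -> : aone - (r^-1)%:C *: h = (r^-1)%:C *: (r%:C *: aone - h).
    by rewrite scalerBr scalerA -rmorphM mulVf ?gt_eqF// scale1r.
  exact: positive_scale.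
case/positive_sqrt => k [/positive_sa sk kE kC].
have : N l <= 1.
  apply: (@cnorm_le1_of_sqr_sum k) => //.
    by rewrite -kC// lE amulBl amulBr amul1l amul1r amulA.
  by rewrite -kE lE; module R[i] A.
rewrite -[in N h](rescaleK h r0) (bnormZr HN) ger0_norm ?(ltW r0)// => Nl.
by rewrite ger_pMr// lE (cnorm_selfadjoint NC)// expr_le1 ?N_ge0.
Qed.

Lemma positive_anti h : positive h -> positive (- h) -> h = 0.
Proof.
move=> ph pnh; apply: (bnorm_eq0 HN); apply/eqP; rewrite eq_le N_ge0 andbT.
by apply: positive_norm_le => //; rewrite scale0r sub0r.
Qed.

Lemma sqr_sa_eq0 k : sa k -> k ** k = 0 -> k = 0.
Proof.
move=> sk kk; apply: (bnorm_eq0 HN); apply/eqP.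
by rewrite -sqrf_eq0 -(cnorm_selfadjoint NC)// kk (bnorm0 HN).
Qed.

Lemma starM_eq0 x : star x ** x = 0 -> x = 0.
Proof.
move=> xx; apply: (bnorm_eq0 HN); apply/eqP.
by rewrite -sqrf_eq0 -NC xx (bnorm0 HN).
Qed.

Lemma sqr_sum_eq0 h k : sa h -> sa k -> h ** h + k ** k = 0 -> h = 0.
Proof.
move=> sh sk hk; apply: sqr_sa_eq0 => //; apply: positive_anti; first by exists h.
by exists k => //; rewrite -[LHS]add0r -hk; module R[i] A.
Qed.

Lemma cartesian_decomposition x : exists h k,
  [/\ sa h, sa k & x = h + 'i *: k].
Proof.
exists ((2^-1)%:C *: (x + star x)), ((2^-1)%:C *: (- 'i *: (x - star x))); split.
- by apply: selfadjointZ; rewrite /selfadjoint starD starK addrC.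
- apply: selfadjointZ; rewrite /selfadjoint starZ starB starK.
  have -> : (- 'i)^*%C = 'i :> R[i] by apply/eqP; rewrite eq_complex/= opprK oppr0 !eqxx.
  by rewrite scaleNr -scalerN opprB.
- have i2 : 'i * 'i = -1 :> R[i] by rewrite -expr2 sqr_i.
  rewrite !scalerA.
  have -> : 'i * (2^-1)%:C * - 'i = (2^-1)%:C :> R[i].
    by rewrite mulrN mulrAC i2 mulN1r opprK.
  by module R[i] A.
Qed.

(** For [x = h + 'i *: k] the sum [star x ** x + x ** star x] equals [2 (h ** h + k ** k)], a
    positive element whose opposite is positive too. *)
Lemma starM_both_npos x :
  positive (- (star x ** x)) -> positive (- (x ** star x)) -> x = 0.
Proof.
move=> p1 p2; have [h [k [sh sk xE]]] := cartesian_decomposition x.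
have sxE : star x = h - 'i *: k.
  rewrite xE starD starZ sh sk; congr (_ + _).
  by rewrite -scaleNr; congr (_ *: _); apply/eqP; rewrite eq_complex/= oppr0 !eqxx.
have i2 : 'i * 'i = -1 :> R[i] by rewrite -expr2 sqr_i.
have hk : (star x ** x + x ** star x) = 2%:C *: (h ** h + k ** k).
  rewrite sxE xE !(amulBl, amulDl, amulBr, amulDr) !(amulZl, amulZr) !scalerA i2.
  by module R[i] A.
have phk : positive (h ** h + k ** k) by apply: positiveD; [exists h|exists k].
have hk0 : h ** h + k ** k = 0.
  apply: positive_anti => //.
  have -> : - (h ** h + k ** k) = (2^-1)%:C *: (- (star x ** x) + - (x ** star x)).
    by rewrite -opprD hk; module R[i] A.
  by apply: positive_scale; [rewrite invr_ge0|exact: positiveD].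
have h0 := sqr_sum_eq0 sh sk hk0.
have k0 : k = 0 by apply: sqr_sa_eq0 => //; move: hk0; rewrite h0 amul0l add0r.
by rewrite xE h0 k0 scaler0 addr0.
Qed.

(** If [star x ** x = - (k ** k)], then for [y = x ** k] both products are negatives of squares:
    [star y ** y] is minus the square of [k ** k], and [y ** star y] minus the square of
    [x ** star x]. So [y = 0], hence [k ** k ** k = 0] and [k ** k = 0]. *)
Lemma starM_npos x : positive (- (star x ** x)) -> x = 0.
Proof.
case=> k sk kE.
have xE : star x ** x = - (k ** k) by rewrite -kE opprK.
have : x ** k = 0.
  apply: starM_both_npos.
    exists (k ** k); first by rewrite /selfadjoint starM sk.
    have -> : star (x ** k) ** (x ** k) = k ** (star x ** x) ** k.
      by rewrite starM sk !amulA.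
    by rewrite xE amulNr amulNl opprK !amulA.
  exists (x ** star x); first by rewrite /selfadjoint starM starK.
  have -> : (x ** star x) ** (x ** star x) = x ** (star x ** x) ** star x.
    by rewrite !amulA.
  by rewrite xE starM sk amulNr amulNl !amulA.
move=> xk; have k3 : k ** k ** k = 0.
  by rewrite -kE amulNl -amulA xk amul0r oppr0.
have k2 : k ** k = 0.
  by apply: sqr_sa_eq0; rewrite ?amulA ?k3 ?amul0l// /selfadjoint starM sk.
by apply: starM_eq0; rewrite xE k2 oppr0.
Qed.

(* With [h = x^* x] and [z = |h| - h] one has [z h z = - |h| z^2], so that
   [x z] satisfies the hypothesis of [starM_npos]. *)
Lemma positive_starM x : positive (star x ** x).
Proof.
set h := star x ** x; have sh : sa h by exact: selfadjoint_starM.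
have [|k [pk kE kC]] := @positive_sqrt (h ** h); first by exists h.
have hk : h ** k = k ** h by rewrite kC// amulA.
have [l [/positive_sa sl lE lC]] := positive_sqrt pk.
have lh : l ** h = h ** l by rewrite lC.
pose z := k - h; have sz : sa z by exact: selfadjointB (positive_sa pk) sh.
have lz : l ** z = z ** l by rewrite amulBr amulBl lh lE amulA.
have slz : sa (l ** z) by rewrite /selfadjoint starM sl sz lz.
have zhz : z ** h ** z = - ((l ** z) ** (l ** z)).
  have -> : z ** h = - (z ** k) by rewrite !amulBl kE hk; module R[i] A.
  by rewrite amulNl lE lz -!amulA lz -lz.
have sxz : star (x ** z) ** (x ** z) = z ** h ** z by rewrite starM sz !amulA.
have xz : x ** z = 0.
  by apply: starM_npos; exists (l ** z) => //; rewrite sxz zhz opprK.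
have hz : h ** z = 0 by rewrite -amulA xz amul0r.
have lz0 : l ** z = 0.
  by apply: sqr_sa_eq0 => //; apply: oppr_inj; rewrite -zhz -amulA hz amul0r oppr0.
have kz : k ** z = 0 by rewrite lE -amulA lz0 amul0r.
have : z = 0 by apply: sqr_sa_eq0 => //; rewrite {1}/z amulBl kz hz subr0.
by move/eqP; rewrite subr_eq0 => /eqP <-.
Qed.

(** Such an [f] maps squares of selfadjoint elements to such squares, so it preserves the inequality
    [star x ** x <= N x ^+ 2], and [positive_norm_le] turns the result into a norm bound. *)
Lemma star_endomorphism_contractive (f : A -> A) :
  linear f -> f aone = aone -> {morph f : x y / x ** y} ->
  {morph f : x / star x} -> forall x, N (f x) <= N x.
Proof.
move=> f_lin f1 fM fS x.
have f_pos h : positive h -> positive (f h).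
  by move=> [k sk ->]; exists (f k); [rewrite /selfadjoint -fS sk|exact: fM].
rewrite -(@ler_pXn2r _ 2) ?nnegrE ?N_ge0// -NC.
apply: positive_norm_le; [exact: sqr_ge0|exact: positive_starM|].
have := f_pos _ (positive_norm_sub (selfadjoint_starM x)).
suff -> : f ((N (star x ** x))%:C *: aone - star x ** x) =
  (N x ^+ 2)%:C *: aone - star (f x) ** f x by [].
have f0 : f 0 = 0 by have := f_lin (-1) 0 0; rewrite scaler0 addr0 scaleN1r addNr.
rewrite addrC -scaleN1r f_lin -[_ *: aone]addr0 f_lin f0 f1 fM fS NC.
by module R[i] A.
Qed.

End Positivity.

(** * Hahn--Banach and states *)

Section HahnBanach.
Context (R : realType) (V : lmodType R).
Implicit Types (p q : V -> R) (x y : V) (r : R).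

Definition sublinear p :=
  (forall x y, p (x + y) <= p x + p y) /\
  (forall r x, 0 < r -> p (r *: x) = r * p x).

Lemma sublinear0 p : sublinear p -> p 0 = 0.
Proof. by case=> _ /(_ 2 0 (ltr0n _ 2)); rewrite scaler0; lra. Qed.

Lemma sublinearN_le p x : sublinear p -> - p (- x) <= p x.
Proof.
by move=> sp; have := sp.1 x (- x); rewrite subrr sublinear0//; lra.
Qed.

(* Both the infimum of a chain and [x |-> inf_t (q (x + t y) - t q y)] are
   instances. *)
Lemma sublinear_inf (I : Type) (D : set I) (f : I -> V -> R) (lb : V -> R) :
  D !=set0 ->
  (forall i x, D i -> lb x <= f i x) ->
  (forall i j x y, D i -> D j ->
     exists2 k, D k & f k (x + y) <= f i x + f j y) ->
  (forall i r x, D i -> 0 < r -> exists2 j, D j & f j (r *: x) <= r * f i x) ->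
  sublinear (fun x => inf [set f i x | i in D]) /\
  forall i x, D i -> inf [set f i x | i in D] <= f i x.
Proof.
move=> [i0 D0] flb fD fZ; set g := fun x => inf _.
have gle i x : D i -> g x <= f i x.
  move=> Di; apply: ge_inf; last by exists i.
  by exists (lb x) => _ [j Dj <-]; exact: flb.
have leg x c : (forall i, D i -> c <= f i x) -> c <= g x.
  move=> h; apply: lb_le_inf; first by exists (f i0 x), i0.
  by move=> _ [j Dj <-]; exact: h.
have gZ r x : 0 < r -> g (r *: x) <= r * g x.
  move=> r0; rewrite -ler_pdivrMl//; apply: leg => i Di.
  have [j Dj hj] := fZ i r x Di r0.
  by rewrite ler_pdivrMl// (le_trans _ hj)// gle.
split=> //; split=> [x y|r x r0].
  rewrite -lerBlDr; apply: (leg) => i Di; rewrite lerBlDr -lerBlDl.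
  apply: leg => j Dj; rewrite lerBlDl.
  by have [k Dk] := fD i j x y Di Dj; apply: le_trans; exact: gle.
apply/eqP; rewrite eq_le gZ//= -ler_pdivlMl// -{1}[x](scalerK (lt0r_neq0 r0)).
by rewrite gZ// invr_gt0.
Qed.

Lemma sublinear_minimal p : sublinear p -> exists q,
  [/\ sublinear q, forall x, q x <= p x &
    forall q', sublinear q' -> (forall x, q' x <= q x) -> q' = q].
Proof.
move=> sp; pose T := {q | sublinear q /\ forall x, q x <= p x}.
pose Q q := sublinear q /\ forall x, q x <= p x.
pose t0 : T := exist Q p (conj sp (fun x => lexx (p x))).
pose ge (q q' : T) := `[< forall x, sval q' x <= sval q x >].
have [||C totC|[q [sq qp]] qmin] := @ZL_preorder T t0 ge.
- by move=> q; apply/asboolP.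
- move=> q1 q2 q3 /asboolP h1 /asboolP h2; apply/asboolP => x.
  exact: le_trans (h2 x) (h1 x).
(* The empty chain is bounded by [p] itself. Otherwise the pointwise infimum is a bound, finite
   because every member is at least [- p (- x)]. *)
- have [[c0 Cc0]|C0] := pselect (C !=set0); last first.
    by exists t0 => s Cs; case: C0; exists s.
  have [||||si lei] := @sublinear_inf T C sval (fun x => - p (- x)).
  + by exists c0.
  + move=> [q [sq qp]] x _ /=; apply: le_trans (sublinearN_le x sq).
    by rewrite lerN2.
  + move=> q q' x y Cq Cq'; have [/asboolP h|/asboolP h] := totC _ _ Cq Cq'.
      exists q' => //; apply: le_trans ((svalP q').1.1 x y) _.
      by rewrite lerD2r.
    exists q => //; apply: le_trans ((svalP q).1.1 x y) _.
    by rewrite lerD2l.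
  + by move=> q r x Cq r0; exists q => //; rewrite (svalP q).1.2.
  have ip x : inf [set sval q x | q in C] <= p x.
    by rewrite (le_trans (lei c0 x Cc0))//; case: (svalP c0).
  exists (exist Q _ (conj si ip)) => s Cs; apply/asboolP => x /=.
  exact: lei.
exists q; split=> // q' sq' q'q.
have q'p x : q' x <= p x by exact: le_trans (q'q x) (qp x).
have /= := qmin (exist Q q' (conj sq' q'p)).
move=> /(_ (asboolT q'q)) /asboolP /= qq'.
by apply/funext => x; apply/eqP; rewrite eq_le q'q qq'.
Qed.

(** In the infimum over [t >= 0], the value [t = 0] gives [q <= p], and [t = 1] at the point [- y]
    gives [q (- y) <= - p y]. *)
Lemma sublinear_shift p y : sublinear p -> exists q,
  [/\ sublinear q, forall x, q x <= p x & q (- y) <= - p y].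
Proof.
move=> sp; have p0 := sublinear0 sp; have [pD pZ] := sp.
pose f (t : R) x := p (x + t *: y) - t * p y.
have pZ0 t x : 0 <= t -> p (t *: x) = t * p x.
  by rewrite le_eqVlt => /orP[/eqP<-|/pZ//]; rewrite scale0r p0 mul0r.
have [||||sg gle] := @sublinear_inf R [set t | 0 <= t] f (fun x => - p (- x)).
- by exists 0 => /=.
- move=> t x /= t0; rewrite /f -pZ0//.
  have := pD (x + t *: y) (- x).
  by rewrite addrAC subrr add0r; lra.
- move=> s t x x' /= s0 t0; exists (s + t); rewrite /= ?addr_ge0// /f.
  by rewrite scalerDl addrACA; have := pD (x + s *: y) (x' + t *: y); lra.
- move=> t r x /= t0 r0; exists (r * t); rewrite /= ?mulr_ge0 ?(ltW r0)// /f.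
  by rewrite -scalerA -scalerDr pZ//; lra.
eexists; split; first exact: sg.
  by move=> x; rewrite (le_trans (gle 0 x _))//= /f scale0r addr0 mul0r subr0.
by rewrite (le_trans (gle 1 _ _))//= /f scale1r addNr p0 mul1r sub0r.
Qed.

(* A minimal sublinear functional is additive, as [sublinear_shift] cannot
   lower it. *)
Theorem hahn_banach p x0 : sublinear p ->
  exists f : V -> R, [/\ scalar f, forall x, f x <= p x & f x0 = p x0].
Proof.
(* The shift along [x0] forces [f (- x0) <= - p x0] for every [f <= p1]; once [f] is odd, this gives
   [f x0 = p x0]. *)
move=> sp; have [p1 [sp1 p1p p1x0]] := sublinear_shift x0 sp.
have [f [sf fp1 fmin]] := sublinear_minimal sp1.
have fN x : f (- x) = - f x.
  have [g [sg gf gx]] := sublinear_shift x sf.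
  have gE := fmin _ sg gf; rewrite gE in gx.
  by have := sublinearN_le (- x) sf; rewrite opprK; lra.
have fD x y : f (x + y) = f x + f y.
  apply/eqP; rewrite eq_le sf.1 /=.
  by have := sf.1 (x + y) (- y); rewrite addrK fN; lra.
have fZ r x : f (r *: x) = r * f x.
  have [r0|r0|->] := ltgtP r 0; last by rewrite scale0r mul0r sublinear0.
  - by rewrite -[r]opprK scaleNr fN sf.2 ?oppr_gt0 //; ring.
  - exact: sf.2.
exists f; split=> [r x y|x|]; first by rewrite fD fZ.
- exact: le_trans (fp1 x) (p1p x).
- by have := fp1 (- x0); have := fp1 x0; have := p1p x0; rewrite fN; lra.
Qed.

End HahnBanach.

(** A copy of [V], so that the real scalars needed for Hahn--Banach do not clash with the complex
    module structure. *)
Definition realification (R : realType) (V : lmodType R[i]) : Type := V.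

Section Realification.
Context (R : realType) (V : lmodType R[i]).
Local Open Scope complex_scope.

HB.instance Definition _ := GRing.Zmodule.on (realification V).

Definition real_scale (r : R) (v : realification V) : realification V :=
  r%:C *: (v : V).

Fact real_scaleA r s v : real_scale r (real_scale s v) = real_scale (r * s) v.
Proof. by rewrite /real_scale scalerA -rmorphM. Qed.

Fact real_scale1 : left_id 1 real_scale.
Proof. by move=> v; rewrite /real_scale scale1r. Qed.

Fact real_scaleDr : right_distributive real_scale +%R.
Proof. by move=> r u v; rewrite /real_scale -scalerDr. Qed.

Fact real_scaleDl v : {morph real_scale^~ v : r s / r + s}.
Proof. by move=> r s; rewrite /real_scale rmorphD scalerDl. Qed.

HB.instance Definition _ := GRing.Zmodule_isLmodule.Build R (realification V)
  real_scaleA real_scale1 real_scaleDr real_scaleDl.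

End Realification.

Section States.
Context (R : realType) (A : starAlgType R) (N : A -> R).
Hypothesis HN : banach_algebra_norm N.
Hypothesis NC : forall x, N (amul (star x) x) = N x ^+ 2.
Local Open Scope complex_scope.
Local Notation "x ** y" := (amul x y) (at level 40, left associativity).
Implicit Types (x y z h k : A) (a : R[i]) (r t : R).

(** The inequality at [aone] admits the zero functional, the only one that exists on the zero
    algebra. *)
Definition state (phi : A -> R[i]) : Prop :=
  [/\ scalar phi, forall x, phi (star x) = (phi x)^*%C,
      forall x, 0 <= phi (star x ** x) & phi aone <= 1].

(** From [aone + h <= N (aone + h)] follows [h <= N (aone + h) - 1]. Because of this additivity, a
    functional that norms [aone + h] norms [aone] and [h] at once. *)
Lemma norm_1D_positive h : N aone = 1 -> positive h ->
  N (aone + h) = 1 + N h.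
Proof.
move=> N1 ph; apply/eqP; rewrite eq_le -{1}N1 (bnormD HN)/=.
have p1h : positive (aone + h) by apply: (positiveD HN NC) => //; exact: positive1.
have pN := positive_norm_sub HN NC (positive_sa p1h).
have : 1 <= N (aone + h).
  rewrite -N1; apply: (positive_norm_le HN NC); [exact: bnorm_ge0|exact: positive1|].
  by apply: (positive_ext _ (positiveD HN NC pN ph)); module R[i] A.
move=> N1h; rewrite -lerBrDl; apply: (positive_norm_le HN NC) => //.
  by rewrite subr_ge0.
by apply: (positive_ext _ pN); module R[i] A.
Qed.

(** The element [N h - h] lies between [0] and [N h], so its norm is at most [N h]; since [f] sends
    it to [N h - f h], the sign of [f h] follows. *)
Lemma positive_of_unital_contraction (f : realification A -> R) h :
  scalar f -> (forall x, f x <= N x) -> f (aone : A) = 1 -> positive h -> 0 <= f h.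
Proof.
move=> f_lin fN f1 ph.
have fE : f ((N h)%:C *: aone - h : A) = N h - f h.
  have -> : (N h)%:C *: aone - h = (-1)%:C *: h + (N h)%:C *: aone.
    by module R[i] A.
  have f0 : f (0 : A) = 0.
    by have := f_lin 1 (0 : A) (0 : A); rewrite scaler0 addr0 mul1r; lra.
  rewrite (f_lin (-1) h ((N h)%:C *: aone)).
  by have := f_lin (N h) (aone : A) (0 : A); rewrite !addr0 f0 f1 => ->; lra.
have : f ((N h)%:C *: aone - h : A) <= N h; last by rewrite fE; lra.
apply: (le_trans (fN _)); apply: (positive_norm_le HN NC).
- exact: bnorm_ge0.
- exact: (positive_norm_sub HN NC (positive_sa ph)).
- by rewrite subKr.
Qed.

Lemma state_exists x : exists2 phi, state phi & phi (star x ** x) = (N x ^+ 2)%:C.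
Proof.
have [N1|N1] := eqVneq (N aone) 0.
  have x0 : x = 0.
    by rewrite -[x](amul1l) (bnorm_eq0 HN N1) amul0l.
  exists (fun=> 0); last by rewrite x0 (bnorm0 HN) expr0n.
  by split=> [a y z|y|y|]; rewrite ?mulr0 ?addr0 ?conjc0.
have {}N1 : N aone = 1.
  have := NC aone; rewrite star1 amul1l expr2 => /eqP.
  by rewrite -{1}[N aone]mulr1 (inj_eq (mulfI N1)) eq_sym => /eqP.
have ph := positive_starM HN NC x; set h := star x ** x in ph *.
have sN : @sublinear R (realification A) N.
  split=> [y z|r y r0]; first exact: (bnormD HN).
  by rewrite (bnormZr HN) gtr0_norm.
have [f [f_lin fN fh]] := @hahn_banach _ (realification A) _ (aone + h : A) sN.
have fD (y z : A) : f (y + z : A) = f y + f z.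
  by have := f_lin 1 y z; rewrite scale1r mul1r.
have f0 : f (0 : A) = 0 by have := fD 0 0; rewrite addr0; lra.
have fZ r (y : A) : f (r%:C *: y : A) = r * f y.
  by have := f_lin r y (0 : A); rewrite !addr0 f0 addr0.
(* [f] is at most [N] on each of [aone] and [h] and attains [1 + N h] on their sum. *)
have [f1 fhE] : f (aone : A) = 1 /\ f h = N h.
  move: fh; rewrite fD (norm_1D_positive N1 ph).
  by have := fN (aone : A); have := fN h; rewrite N1; split; lra.
(* Averaging over the involution leaves [f] unchanged on selfadjoint elements and makes its
   complexification [phi] hermitian. *)
pose g (y : A) := f ((2^-1)%:C *: (y + star y) : A).
have gE y : selfadjoint y -> g y = f y.
  rewrite /g => ->; congr f; module R[i] A.
have gD y z : g (y + z) = g y + g z.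
  by rewrite /g -fD; congr f; rewrite starD; module R[i] A.
have gZ r y : g (r%:C *: y) = r * g y.
  by rewrite /g -fZ; congr f; rewrite starZr; module R[i] A.
have gS y : g (star y) = g y by rewrite /g starK addrC.
have gi y : selfadjoint y -> g ('i *: y) = 0.
  move=> sy; rewrite /g starZ sy.
  have -> : 'i^*%C = - 'i :> R[i] by apply/eqP; rewrite eq_complex/= oppr0 !eqxx.
  by rewrite scaleNr subrr scaler0.
have gN y : g (- y) = - g y by have := gZ (-1) y; rewrite rmorphN1 scaleN1r mulN1r.
have giS y : g ('i *: star y) = - g ('i *: y).
  rewrite -[in RHS]gS -gN starZ; congr g.
  have -> : 'i^*%C = - 'i :> R[i] by apply/eqP; rewrite eq_complex/= oppr0 !eqxx.
  by rewrite scaleNr opprK.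
pose phi y : R[i] := g y -i* g ('i *: y).
have phiE y : selfadjoint y -> phi y = (f y)%:C.
  by move=> sy; rewrite /phi gE// gi// oppr0.
exists phi; last first.
  by rewrite phiE; [rewrite fhE NC|exact: selfadjoint_starM].
split.
- move=> [u v] y z.
  have -> : (u +i* v) *: y = u%:C *: y + v%:C *: ('i *: y).
    by rewrite scalerA -scalerDl; congr (_ *: _); simpc.
  have iE : 'i *: (u%:C *: y + v%:C *: ('i *: y) + z) =
      u%:C *: ('i *: y) + (- v)%:C *: y + 'i *: z.
    by rewrite !scalerDr !scalerA; congr (_ *: _ + _ *: _ + _); simpc.
  rewrite /phi iE !gD !gZ.
  by apply/eqP; rewrite eq_complex/=; apply/andP; split; apply/eqP; ring.
- by move=> y; rewrite /phi gS giS.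
- move=> y; rewrite phiE; last exact: selfadjoint_starM.
  rewrite ler0c; apply: positive_of_unital_contraction => //.
  exact: (positive_starM HN NC).
- by rewrite phiE ?f1//; exact: selfadjoint1.
Qed.

(** With [N x ^+ 2 - star x ** x = k ** k], the difference of the two sides is the value of [phi] at
    [star (k ** y) ** (k ** y)]. *)
Lemma state_bound phi x y : state phi ->
  phi (star (x ** y) ** (x ** y)) <= (N x ^+ 2)%:C * phi (star y ** y).
Proof.
move=> [phi_lin _ phi_ge0 _].
have [k sk kE] := positive_norm_sub HN NC (selfadjoint_starM x).
have phi0 : phi 0 = 0.
  have := phi_lin 0 0 0; rewrite scaler0 addr0 mul0r add0r.
  by have := phi_lin (-1) 0 0; rewrite scaler0 addr0 mulN1r addNr.
rewrite -subr_ge0.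
suff -> : (N x ^+ 2)%:C * phi (star y ** y) - phi (star (x ** y) ** (x ** y)) =
    phi (star (k ** y) ** (k ** y)) by [].
have -> : star (k ** y) ** (k ** y) =
    (N x ^+ 2)%:C *: (star y ** y) - star (x ** y) ** (x ** y).
  rewrite !starM sk -amulA (amulA k) -kE NC amulBl amulBr amulZl amul1l amulZr.
  by rewrite !amulA.
have -> : (N x ^+ 2)%:C *: (star y ** y) - star (x ** y) ** (x ** y) =
  -1 *: (star (x ** y) ** (x ** y)) + ((N x ^+ 2)%:C *: (star y ** y) + 0).
  by module R[i] A.
by rewrite !phi_lin phi0 mulN1r addr0 addrC.
Qed.

End States.

(** * Pre-Hilbert spaces and their completions *)

Section ComplexModulus.
Context (R : realType).
Local Open Scope complex_scope.
Implicit Types (a b c : R[i]) (r : R).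
Local Notation normc := (@Normc.normc R).

Lemma normc_ge0 a : 0 <= normc a.
Proof. by case: a => x y; exact: sqrtr_ge0. Qed.

Lemma normc_sub a b c : normc (a - c) <= normc (a - b) + normc (b - c).
Proof. by have := le_normcD (a - b) (b - c); rewrite addrA subrK. Qed.

Lemma normcBC a b : normc (a - b) = normc (b - a).
Proof. by rewrite -opprB normcN. Qed.

Lemma normc_ge_absRe a : `|complex.Re a| <= normc a.
Proof.
case: a => x y /=; rewrite -sqrtr_sqr ler_sqrt ?addr_ge0 ?sqr_ge0//.
by rewrite lerDl sqr_ge0.
Qed.

Lemma normc_ge_absIm a : `|complex.Im a| <= normc a.
Proof.
case: a => x y /=; rewrite -sqrtr_sqr ler_sqrt ?addr_ge0 ?sqr_ge0//.
by rewrite lerDr sqr_ge0.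
Qed.

Lemma normc_le_ReIm a : normc a <= `|complex.Re a| + `|complex.Im a|.
Proof.
case: a => x y /=; rewrite -[leRHS]ger0_norm ?addr_ge0// -sqrtr_sqr.
rewrite ler_sqrt ?sqr_ge0// sqrrD !real_normK ?num_real//.
by rewrite lerD2r lerDl mulrn_wge0 ?mulr_ge0.
Qed.

Lemma normc_real r : normc r%:C = `|r|.
Proof. by rewrite /= expr0n/= addr0 sqrtr_sqr. Qed.

Lemma normc_conj a : normc a^*%C = normc a.
Proof. by case: a => x y /=; rewrite sqrrN. Qed.

Lemma conjcM a b : (a * b)^*%C = a^*%C * b^*%C.
Proof. exact: rmorphM. Qed.

Lemma mulc_conj a : a * a^*%C = (normc a ^+ 2)%:C.
Proof. by case: a => x y; rewrite /= sqr_sqrtr ?addr_ge0 ?sqr_ge0//; simpc; rewrite -!expr2 mulrC addNr. Qed.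

Lemma normc_le_eps_eq a b (C : R) :
  (forall e, 0 < e -> e <= 1 -> normc (a - b) <= C * e) -> a = b.
Proof.
move=> h; apply/eqP; rewrite -subr_eq0; apply/eqP/Normc.eq0_normc.
by apply/eqP; rewrite eq_le normc_ge0 andbT; exact: le0_of_le_eps h.
Qed.

Lemma real_complete : complete_on (fun x : R => `|x|) predT.
Proof.
move=> u _ uC.
have : cvg (u @ \oo).
  apply/cauchy_cvgP/cauchy_exP => e e0; have [n0 hn0] := uC _ e0.
  by exists (u n0), n0 => // n /= n0n; apply: hn0.
move=> /cvg_ex[l ul]; exists l => //.
apply/(@converges_toP _ _ (fun x : R => `|x|)) => // e e0.
by have /cvgrPdist_lt/(_ _ e0)[n0 _ hn] := ul; exists n0 => n /hn; rewrite distrC.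
Qed.

Lemma complex_complete : complete_on normc predT.
Proof.
move=> u _ uC.
have [|l _ /(converges_toP (N := fun x : R => `|x|) (@normr_ge0 _ _)) lP] :=
    @real_complete (fun n => complex.Re (u n)) (fun=> isT).
  move=> e /uC[n0 hn]; exists n0 => m n n0m n0n; apply: le_lt_trans (hn m n n0m n0n).
  by apply: le_trans (normc_ge_absRe _); case: (u m) (u n) => ? ? [].
have [|k _ /(converges_toP (N := fun x : R => `|x|) (@normr_ge0 _ _)) kP] :=
    @real_complete (fun n => complex.Im (u n)) (fun=> isT).
  move=> e /uC[n0 hn]; exists n0 => m n n0m n0n; apply: le_lt_trans (hn m n n0m n0n).
  by apply: le_trans (normc_ge_absIm _); case: (u m) (u n) => ? ? [].
exists (l +i* k) => //; apply/(converges_toP normc_ge0) => e e0.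
have e2 : 0 < e / 2 by rewrite divr_gt0.
have [n0 hn0] := lP _ e2; have [n1 hn1] := kP _ e2.
exists (maxn n0 n1) => n; rewrite geq_max => /andP[/hn0 h0 /hn1 h1].
apply: (le_lt_trans (normc_le_ReIm _)).
by case: (u n) h0 h1 => x y /=; rewrite [_ - l]/= => h0 h1; lra.
Qed.

End ComplexModulus.

(** * Hermitian forms and the Cauchy--Schwarz inequality *)

Section HermitianForms.
Context (R : realType) (V : lmodType R[i]) (g : V -> V -> R[i]).
Local Open Scope complex_scope.
Implicit Types (x y z : V) (a : R[i]).

Definition hermitian_form : Prop :=
  (forall x, scalar (g x)) /\ (forall x y, g y x = (g x y)^*%C).

Hypothesis gH : hermitian_form.

Let g_lin x a y z : g x (a *: y + z) = a * g x y + g x z.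
Proof. by case: gH => + _; apply. Qed.

Lemma formC x y : g y x = (g x y)^*%C.
Proof. by case: gH => _; apply. Qed.

Lemma form0r x : g x 0 = 0.
Proof.
have := g_lin x 1 0 0; rewrite scale1r mul1r addr0 => /eqP.
by rewrite -{1}[g x 0]addr0 (inj_eq (addrI _)) eq_sym => /eqP.
Qed.

Lemma formDr x y z : g x (y + z) = g x y + g x z.
Proof. by have := g_lin x 1 y z; rewrite scale1r mul1r. Qed.

Lemma formZr x a y : g x (a *: y) = a * g x y.
Proof. by have := g_lin x a y 0; rewrite form0r !addr0. Qed.

Lemma formNr x y : g x (- y) = - g x y.
Proof. by rewrite -scaleN1r formZr mulN1r. Qed.

Lemma formBr x y z : g x (y - z) = g x y - g x z.
Proof. by rewrite formDr formNr. Qed.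

Lemma formDl z x y : g (x + y) z = g x z + g y z.
Proof. by rewrite !(formC z) formDr rmorphD. Qed.

Lemma formZl y a x : g (a *: x) y = a^*%C * g x y.
Proof. by rewrite !(formC y) formZr rmorphM. Qed.

Lemma formNl y x : g (- x) y = - g x y.
Proof. by rewrite !(formC y) formNr rmorphN. Qed.

Lemma formBl z x y : g (x - y) z = g x z - g y z.
Proof. by rewrite formDl formNl. Qed.

End HermitianForms.

Section SemiInnerProduct.
Context (R : realType) (V : lmodType R[i]) (g : V -> V -> R[i]).
Local Open Scope complex_scope.
Implicit Types (x y z : V) (a : R[i]).
Local Notation normc := (@Normc.normc R).

Definition semi_inner_product : Prop :=
  hermitian_form g /\ forall x, 0 <= g x x.

Definition seminorm x : R := Num.sqrt (complex.Re (g x x)).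

Hypothesis gP : semi_inner_product.
Let gH := gP.1.

Lemma sip_ge0 x : 0 <= g x x.
Proof. by case: gP => _; apply. Qed.

Lemma Re_sip_ge0 x : 0 <= complex.Re (g x x).
Proof. by have := sip_ge0 x; rewrite lecE => /andP[]. Qed.

Lemma seminorm_ge0 x : 0 <= seminorm x. Proof. exact: sqrtr_ge0. Qed.

Lemma sqr_seminorm x : seminorm x ^+ 2 = complex.Re (g x x).
Proof. by rewrite sqr_sqrtr ?Re_sip_ge0. Qed.

Lemma sipxx x : g x x = (seminorm x ^+ 2)%:C.
Proof.
rewrite sqr_seminorm; have := ger0_Im (sip_ge0 x).
by case: (g x x) => u v /= ->.
Qed.

Lemma cauchy_schwarz x y : normc (g x y) <= seminorm x * seminorm y.
Proof.
set p := normc (g x y); have p_ge0 : 0 <= p by exact: normc_ge0.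
set m := seminorm x; set q := seminorm y.
have m0 : 0 <= m by exact: seminorm_ge0. have q0 : 0 <= q by exact: seminorm_ge0.
(* The form evaluated at [x - t <y|x> y], which is a real polynomial in [t]. *)
have key (t : R) : 0 <= m ^+ 2 - 2 * t * p ^+ 2 + t ^+ 2 * p ^+ 2 * q ^+ 2.
  have := sip_ge0 (x - (t%:C * g y x) *: y).
  rewrite (formBl gH) !(formBr gH) !(formZl gH, formZr gH) !sipxx -/m -/q (formC gH x y).
  rewrite conjcM conjcK conjc_real.
  set c := g x y; have cc := mulc_conj c; rewrite -/p in cc.
  have -> : (m ^+ 2)%:C - t%:C * c^*%C * c - (t%:C * c * c^*%C - t%:C * c * (t%:C * c^*%C * (q ^+ 2)%:C))
     = (m ^+ 2)%:C - 2%:R * t%:C * (c * c^*%C) + t%:C ^+ 2 * (c * c^*%C) * (q ^+ 2)%:C by ring.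
  rewrite cc.
  have -> : (m ^+ 2)%:C - 2%:R * t%:C * (p ^+ 2)%:C + t%:C ^+ 2 * (p ^+ 2)%:C * (q ^+ 2)%:C
     = (m ^+ 2 - 2 * t * p ^+ 2 + t ^+ 2 * p ^+ 2 * q ^+ 2)%:C by ring.
  by rewrite ler0c.
have [->|/eqP pn0] := eqVneq p 0; first exact: mulr_ge0.
have p0 : 0 < p ^+ 2 by rewrite exprn_gt0// lt_neqAle p_ge0 eq_sym; apply/andP; split=> //; exact/eqP.
rewrite -(@ler_pXn2r _ 2) ?nnegrE ?mulr_ge0// exprMn.
have [qz|/eqP qn0] := eqVneq q 0.
  (* A vector [y] of seminorm [0] need not vanish. The polynomial is then affine in [t], and this
     [t] gives it the value [-1]. *)
  have := key ((m ^+ 2 + 1) / (2 * p ^+ 2)); rewrite qz.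
  have -> : m ^+ 2 - 2 * ((m ^+ 2 + 1) / (2 * p ^+ 2)) * p ^+ 2 +
    ((m ^+ 2 + 1) / (2 * p ^+ 2)) ^+ 2 * p ^+ 2 * 0 ^+ 2 = -1.
    by rewrite expr0n/= mulr0 addr0; field; exact/eqP.
  by lra.
have q20 : 0 < q ^+ 2 by rewrite exprn_gt0// lt_neqAle q0 eq_sym; apply/andP; split=> //; exact/eqP.
(* The minimum of the polynomial. *)
have := key (q ^- 2).
have -> : m ^+ 2 - 2 * q ^- 2 * p ^+ 2 + q ^- 2 ^+ 2 * p ^+ 2 * q ^+ 2 =
  m ^+ 2 - p ^+ 2 / q ^+ 2 by field; exact/eqP.
by rewrite subr_ge0 ler_pdivrMr.
Qed.

Lemma seminormZ a x : seminorm (a *: x) = normc a * seminorm x.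
Proof.
apply/eqP; rewrite -(@eqrXn2 _ 2)// ?mulr_ge0 ?normc_ge0 ?seminorm_ge0//.
rewrite sqr_seminorm (formZl gH) (formZr gH) mulrA [_^*%C * _]mulrC mulc_conj sipxx -rmorphM /=.
by rewrite exprMn.
Qed.

Lemma seminormN x : seminorm (- x) = seminorm x.
Proof. by rewrite /seminorm (formNl gH) (formNr gH) opprK. Qed.

Lemma seminormBC x y : seminorm (x - y) = seminorm (y - x).
Proof. by rewrite -seminormN opprB. Qed.

Lemma seminorm0 : seminorm 0 = 0.
Proof. by rewrite /seminorm (form0r gH) sqrtr0. Qed.

Lemma seminormD x y : seminorm (x + y) <= seminorm x + seminorm y.
Proof.
rewrite -(@ler_pXn2r _ 2) ?nnegrE ?addr_ge0 ?seminorm_ge0//.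
rewrite sqr_seminorm (formDl gH) !(formDr gH) !sipxx (formC gH x y).
have := le_trans (normc_ge_absRe _) (cauchy_schwarz x y).
case: (g x y) => u v /=; rewrite ler_norml => /andP[_ h].
by rewrite sqrrD; lra.
Qed.

Lemma seminormB x y : seminorm (x - y) <= seminorm x + seminorm y.
Proof. by rewrite -(seminormN y) seminormD. Qed.

Lemma seminorm_sub x y z : seminorm (x - z) <= seminorm (x - y) + seminorm (y - z).
Proof. by have := seminormD (x - y) (y - z); rewrite addrA subrK. Qed.

End SemiInnerProduct.

(** Only semidefinite: null vectors induce the zero functional, so the completion below identifies
    them with [0] without a separate quotient. *)
HB.mixin Record isPreHilbert (R : realType) V & HermitianSpace R V := {
  kform_ge0 : forall x : V, 0 <= kform x x
}.

#[short(type="preHilbertType")]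
HB.structure Definition PreHilbert (R : realType) :=
  {V of HermitianSpace R V & isPreHilbert R V}.

HB.mixin Record isHilbert (R : realType) H & PreHilbert R H := {
  kform_definite : forall x : H, kform x x = 0 -> x = 0;
  kform_complete : complete_on (seminorm (@kform R H)) predT
}.

#[short(type="hilbertType")]
HB.structure Definition Hilbert (R : realType) :=
  {H of PreHilbert R H & isHilbert R H}.

Lemma preHilbertP (R : realType) (V : preHilbertType R) :
  semi_inner_product (@kform R V).
Proof.
by split; [split; [exact: kform_linear|exact: kform_herm]|exact: kform_ge0].
Qed.

(** * Completion by approximable functionals *)

Section Completion.
Context (R : realType) (V : preHilbertType R).
Local Open Scope complex_scope.
Local Notation normc := (@Normc.normc R).
Local Notation "<| x , y |>" := (kform x y).
Local Notation sn := (seminorm (@kform R V)).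
Local Notation gP := (preHilbertP V).
Local Notation sn_ge0 := (seminorm_ge0 (@kform R V)).
Implicit Types (f h : V -> R[i]^o) (v w : V) (e M : R).

Definition approximated f v e := forall w, normc (f w - <|w, v|>) <= e * sn w.

(* A point of the completion is the conjugate-linear functional that it induces
   on [V]: operators then extend by precomposition with their adjoint. *)
Definition completion_pred : {pred V -> R[i]^o} := fun f =>
  `[< (forall (a : R[i]) v w, f (a *: v + w) = a^*%C * f v + f w) /\
      forall e, 0 < e -> exists v, approximated f v e >].

Definition dual_bound f M := forall w, normc (f w) <= M * sn w.

Lemma approximatedD a f h v w e e' : approximated f v e ->
  approximated h w e' ->
  approximated (a *: f + h) (a *: v + w) (normc a * e + e').
Proof.
move=> fv hw z; rewrite (formDr gP.1) (formZr gP.1).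
have -> : (a *: f + h) z - (a * <|z, v|> + <|z, w|>) =
  a * (f z - <|z, v|>) + (h z - <|z, w|>).
  by rewrite mulrBr opprD addrACA.
apply: (le_trans (le_normcD _ _)); rewrite mulrDl lerD// Normc.normcM -mulrA.
by rewrite ler_wpM2l ?normc_ge0.
Qed.

Fact completion_submod_closed : submod_closed completion_pred.
Proof.
split.
  apply/asboolP; split=> [a v w|e e0]; first by rewrite mulr0 addr0.
  exists 0 => w; rewrite (form0r gP.1) subr0 normc_real normr0.
  by rewrite mulr_ge0 ?sn_ge0 ?ltW.
move=> a f h /asboolP[f_lin fa] /asboolP[h_lin ha]; apply/asboolP; split.
  move=> b v w.
  have ahE z : (a *: f + h) z = a * f z + h z by [].
  by rewrite !ahE f_lin h_lin; ring.
move=> e e0; have a0 : 0 < normc a + 1 by rewrite ltr_wpDl ?normc_ge0.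
have e1 : 0 < e / (normc a + 1) by rewrite divr_gt0.
have [v fv] := fa _ e1; have [w hw] := ha _ e1.
exists (a *: v + w).
have -> : e = normc a * (e / (normc a + 1)) + e / (normc a + 1).
  by rewrite -[X in _ + X]mul1r -mulrDl mulrCA mulfV ?mulr1 ?gt_eqF.
exact: approximatedD.
Qed.

HB.instance Definition _ :=
  GRing.isSubmodClosed.Build _ _ completion_pred completion_submod_closed.

Record completion := Completion {
  functional :> V -> R[i]^o;
  functionalP : functional \in completion_pred }.

HB.instance Definition _ := [isSub for functional].
HB.instance Definition _ := [Choice of completion by <:].
HB.instance Definition _ :=
  [SubChoice_isSubLmodule of completion by <:].

Implicit Types F G H : completion.

Lemma functional_antilinear F a v w : F (a *: v + w) = a^*%C * F v + F w.
Proof. by have /asboolP[+ _] := functionalP F; apply. Qed.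

Lemma functionalB F v w : F (v - w) = F v - F w.
Proof.
by rewrite addrC -scaleN1r functional_antilinear rmorphN1 mulN1r addrC.
Qed.

Lemma approximated_exists F e : 0 < e -> exists v, approximated F v e.
Proof. by have /asboolP[_] := functionalP F; apply. Qed.

Lemma approximated_bound f v e : approximated f v e -> dual_bound f (sn v + e).
Proof.
move=> fv w; rewrite -[f w](subrK <|w, v|>) (le_trans (le_normcD _ _))//.
by rewrite mulrDl addrC lerD// mulrC (cauchy_schwarz gP).
Qed.

Lemma dual_bound_exists F : exists2 M, 0 <= M & dual_bound F M.
Proof.
have [v fv] := approximated_exists F (@ltr01 R).
by exists (sn v + 1); [rewrite addr_ge0 ?sn_ge0|exact: approximated_bound].
Qed.

Lemma approximated_norm_le f v e M : 0 <= e -> 0 <= M ->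
  approximated f v e -> dual_bound f M -> sn v <= M + e.
Proof.
move=> e0 M0 fv fM; have [->|v0] := eqVneq (sn v) 0; first exact: addr_ge0.
have {}v0 : 0 < sn v by rewrite lt_neqAle eq_sym v0 sn_ge0.
rewrite -(ler_pM2r v0) -expr2.
have -> : sn v ^+ 2 = normc <|v, v|> by rewrite (sipxx gP) normc_real ger0_norm ?sqr_ge0.
rewrite -[<|v, v|>](subrK (f v)) (le_trans (le_normcD _ _))// mulrDl addrC.
by rewrite lerD// normcBC.
Qed.

(** The vector [v - v'] approximates [f - f], the functional with bound [0]. *)
Lemma approximated_dist f v v' e e' : 0 <= e -> 0 <= e' ->
  approximated f v e -> approximated f v' e' -> sn (v - v') <= e + e'.
Proof.
move=> e0 e'0 fv fv'.
have := @approximatedD (-1) f f v' v e' e fv' fv.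
rewrite !scaleN1r addNr normcN Normc.normc1 mul1r [- v' + v]addrC [e' + e]addrC => h.
rewrite -[leRHS]add0r; apply: (approximated_norm_le _ _ h) => //.
  exact: addr_ge0.
by move=> w; rewrite normc_real normr0 mul0r.
Qed.

Lemma dual_boundB H M v w : dual_bound H M ->
  normc (H v - H w) <= M * sn (v - w).
Proof. by move=> HM; rewrite -functionalB. Qed.

(** As [H v] stands for [<v|H>], the inner product is the limit of [H v] along vectors [v]
    approximating [F]. The estimate determines it independently of the sequence chosen, and is all
    that is used afterwards. *)
Lemma inner_exists F H : exists c : R[i], forall M e v, 0 <= M -> 0 <= e ->
  dual_bound H M -> approximated F v e -> normc (c - H v) <= e * M.
Proof.
have /choice[u uP] : forall n : nat, exists v, approximated F v n.+1%:R^-1.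
  by move=> n; apply: approximated_exists; rewrite invr_gt0.
have small e : 0 < e -> exists n0, forall n, (n0 <= n)%N -> n.+1%:R^-1 < e :> R.
  move=> e0; have [n0 _ hn0] := near_infty_natSinv_lt (PosNum e0).
  by exists n0 => n /hn0.
have inv_ge0 n : 0 <= n.+1%:R^-1 :> R by rewrite invr_ge0.
have dist n v e : 0 <= e -> approximated F v e -> sn (u n - v) <= n.+1%:R^-1 + e.
  by move=> e0 Fv; apply: (approximated_dist _ _ (uP n) Fv).
have [|c _ /(converges_toP (@normc_ge0 R)) cP] :=
    @complex_complete R (fun n => H (u n)) (fun=> isT).
  have [M M0 HM] := dual_bound_exists H.
  move=> e e0; have M1 : 0 < 2 * M + 1 by rewrite ltr_wpDl ?mulr_ge0.
  (* The added [1] covers the case [M = 0]. *)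
  have [|n0 hn0] := small (e / (2 * M + 1)); first by rewrite divr_gt0.
  exists n0 => m n /hn0 hm /hn0 hn; apply: (le_lt_trans (dual_boundB _ _ HM)).
  apply: (@le_lt_trans _ _ ((2 * M) * (e / (2 * M + 1)))); last first.
    by rewrite mulrA ltr_pdivrMr// mulrC ltr_pM2l// ltrDl.
  rewrite -mulrA mulrCA ler_wpM2l// (le_trans (dist _ _ _ (inv_ge0 n) (uP n)))//.
  by move: (e / _) m.+1%:R^-1 n.+1%:R^-1 hm hn => q a b; lra.
exists c => M e v M0 e0 HM Fv; rewrite -subr_le0.
apply: (@le0_of_le_eps _ _ (1 + M)) => d d0 _.
have [n0 hn0] := small _ d0; have [n1 hn1] := cP _ d0.
pose n := maxn n0 n1.
have /ltW h0 := hn0 n (leq_maxl _ _); have /ltW h1 := hn1 n (leq_maxr _ _).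
rewrite lerBlDr (le_trans (normc_sub _ (H (u n)) _))// normcBC mulrDl mul1r.
rewrite -addrA lerD// (le_trans (dual_boundB _ _ HM))// [e * M]mulrC -mulrDr.
by rewrite ler_wpM2l// (le_trans (dist _ _ _ e0 Fv))// lerD2r.
Qed.

Definition inner F H : R[i] := sval (cid (inner_exists F H)).

Lemma inner_approx F H M e v : 0 <= M -> 0 <= e -> dual_bound H M ->
  approximated F v e -> normc (inner F H - H v) <= e * M.
Proof. by rewrite /inner; case: cid => c /= cP; exact: cP. Qed.

Lemma inner_linear F : scalar (inner F).
Proof.
move=> a G H; have [M M0 GM] := dual_bound_exists G.
have [M' M'0 HM] := dual_bound_exists H.
have [K K0 aGHK] := dual_bound_exists (a *: G + H).
apply: (@normc_le_eps_eq _ _ _ (K + (normc a * M + M'))) => e e0 _.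
have [v Fv] := approximated_exists F e0; have {}e0 := ltW e0.
rewrite (le_trans (normc_sub _ ((a *: G + H) v) _))// mulrDl.
rewrite lerD//; first by rewrite [K * e]mulrC inner_approx.
have -> : (a *: G + H) v - (a * inner F G + inner F H) =
    - (a * (inner F G - G v) + (inner F H - H v)).
  have -> : (a *: G + H) v = a * G v + H v by [].
  by ring.
rewrite normcN (le_trans (le_normcD _ _))// mulrDl Normc.normcM lerD//.
  by rewrite -mulrA ler_wpM2l ?normc_ge0// mulrC inner_approx.
by rewrite mulrC inner_approx.
Qed.

Lemma inner_approx2 F H M M' e v w : 0 <= M -> 0 <= M' -> 0 <= e -> e <= 1 ->
  dual_bound F M -> dual_bound H M' -> approximated F v e -> approximated H w e ->
  normc (inner F H - <|v, w|>) <= (M' + (M + 1)) * e.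
Proof.
move=> M0 M'0 e0 e1 FM HM Fv Hw; rewrite (le_trans (normc_sub _ (H v) _))//.
rewrite mulrDl lerD//; first by rewrite mulrC inner_approx.
rewrite (le_trans (Hw v))// mulrC ler_wpM2r//.
by rewrite (le_trans (approximated_norm_le _ _ Fv FM))// lerD2l.
Qed.

Lemma inner_herm F H : inner H F = (inner F H)^*%C.
Proof.
have [M M0 FM] := dual_bound_exists F; have [M' M'0 HM] := dual_bound_exists H.
apply: (@normc_le_eps_eq _ _ _ ((M + (M' + 1)) + (M' + (M + 1)))) => e e0 e1.
have [v Fv] := approximated_exists F e0; have [w Hw] := approximated_exists H e0.
have {}e0 := ltW e0.
rewrite (le_trans (normc_sub _ <|w, v|> _))// mulrDl lerD//.
  exact: inner_approx2.
rewrite (formC gP.1) -rmorphB normc_conj normcBC.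
exact: inner_approx2.
Qed.

Lemma inner_ge0 F : 0 <= inner F F.
Proof.
have [M M0 FM] := dual_bound_exists F.
rewrite lecE; apply/andP; split.
  have := inner_herm F F; case: (inner F F) => x y [] /= /eqP.
  by rewrite -subr_eq0 opprK -mulr2n mulrn_eq0 /= => /eqP ->.
rewrite -oppr_le0; apply: (@le0_of_le_eps _ _ (M + (M + 1))) => e e0 e1.
have [v Fv] := approximated_exists F e0.
have := inner_approx2 M0 M0 (ltW e0) e1 FM FM Fv Fv.
have := Re_sip_ge0 gP v; have := normc_ge_absRe (inner F F - <|v, v|>).
case: (inner F F) <|v, v|> => x y [z t] /=; rewrite ler_norml => /andP[+ _].
by lra.
Qed.


HB.instance Definition _ :=
  hasHermitianForm.Build R completion inner_linear inner_herm.
HB.instance Definition _ := isPreHilbert.Build R completion inner_ge0.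

Local Notation csn := (seminorm (@kform R completion)).
Local Notation cP := (preHilbertP completion).

Fact embed_subproof v : (fun w => <|w, v|>) \in completion_pred.
Proof.
apply/asboolP; split=> [a w w'|e e0].
  by rewrite (formDl gP.1) (formZl gP.1).
by exists v => w; rewrite subrr normc_real normr0 mulr_ge0 ?sn_ge0 ?ltW.
Qed.

Definition embed v : completion := Completion (embed_subproof v).

Lemma embed_approximated v : approximated (embed v) v 0.
Proof. by move=> w; rewrite subrr normc_real normr0 mul0r. Qed.

Lemma inner_embed v F : kform (embed v) F = F v.
Proof.
have [M M0 FM] := dual_bound_exists F.
apply: (@normc_le_eps_eq _ _ _ 0) => e _ _; rewrite mul0r.
by have := inner_approx M0 (lexx 0) FM (embed_approximated v); rewrite mul0r.
Qed.

Lemma embed_norm v : csn (embed v) = sn v.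
Proof. by rewrite /seminorm inner_embed. Qed.

Lemma dual_bound_norm F : dual_bound F (csn F).
Proof.
move=> w; rewrite -inner_embed -embed_norm mulrC.
exact: (cauchy_schwarz cP).
Qed.

(** If [v] approximates [F] within [e], then [<F|F>] is within [e * M] of [F v], and [F v] is at
    most [M * sn v <= M * (M + e)] in modulus. *)
Lemma norm_le_dual_bound F M : 0 <= M -> dual_bound F M -> csn F <= M.
Proof.
move=> M0 FM; rewrite -(@ler_pXn2r _ 2) ?nnegrE ?seminorm_ge0//.
rewrite (sqr_seminorm cP) -subr_le0.
apply: (@le0_of_le_eps _ _ (M + M)) => e e0 _.
have [v Fv] := approximated_exists F e0.
have h1 := inner_approx M0 (ltW e0) FM Fv.
have h2 := FM v; have h3 := approximated_norm_le (ltW e0) M0 Fv FM.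
have h4 := ler_wpM2l M0 h3.
have := normc_ge_absRe (kform F F); have := normc_sub (kform F F) (F v) 0.
rewrite !subr0 ler_norml => h5 /andP[_ h6].
by move: h1 h2 h4 h5 h6; rewrite -[inner F F]/(kform F F) expr2; lra.
Qed.

Fact completion_definite F : kform F F = 0 -> F = 0.
Proof.
move=> F0; apply/val_inj/funext => w; apply: Normc.eq0_normc.
apply/eqP; rewrite eq_le normc_ge0 andbT.
by have := dual_bound_norm F w; rewrite {1}/seminorm F0 sqrtr0 mul0r.
Qed.

(** The functionals converge pointwise, and uniformly relative to [sn]; the limit is approximable
    because a late term is. *)
Fact completion_complete : complete_on csn predT.
Proof.
move=> u _ uC.
have uw w : exists l, converges_to normc (fun n => u n w) l.
  have [|l _ ul] := @complex_complete R (fun n => u n w) (fun=> isT); last by exists l.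
  move=> e e0; have w1 : 0 < sn w + 1 by rewrite ltr_wpDl ?sn_ge0.
  have [|n0 hn0] := uC (e / (sn w + 1)); first by rewrite divr_gt0.
  exists n0 => m n n0m n0n.
  apply: (le_lt_trans (dual_bound_norm (u m - u n) w)).
  have h := hn0 m n n0m n0n; rewrite ltr_pdivlMr// in h.
  apply: le_lt_trans h; rewrite ler_wpM2l ?seminorm_ge0//.
  by rewrite lerDl.
have /choice[f fP] := uw.
have uf e : 0 < e -> exists n0, forall n, (n0 <= n)%N ->
    forall w, normc (f w - u n w) <= e * sn w.
  move=> e0; have [n0 hn0] := uC e e0; exists n0 => n n0n w; rewrite -subr_le0.
  apply: (@le0_of_le_eps _ _ 1) => d d0 _.
  have /(converges_toP (@normc_ge0 R))/(_ _ d0)[n1 hn1] := fP w.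
  have /ltW h1 := hn1 (maxn n0 n1) (leq_maxr _ _).
  have /ltW h2 := hn0 (maxn n0 n1) n (leq_maxl _ _) n0n.
  have h3 := dual_bound_norm (u (maxn n0 n1) - u n) w.
  have h4 := ler_wpM2r (sn_ge0 w) h2.
  have := normc_sub (f w) (u (maxn n0 n1) w) (u n w).
  rewrite (normcBC (f w) (u (maxn n0 n1) w)); move: h1 h3 h4.
  rewrite -[(u _ - u n) w]/(u (maxn n0 n1) w - u n w).
  by lra.
have fC : f \in completion_pred.
  apply/asboolP; split=> [a v w|e e0].
    apply: (@normc_le_eps_eq _ _ _ (sn (a *: v + w) + (normc a * sn v + sn w))).
    move=> e e0 _; have [n /(_ _ (leqnn _)) hn] := uf e e0.
    rewrite (le_trans (normc_sub _ (u n (a *: v + w)) _))// mulrDl lerD//.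
      by rewrite mulrC hn.
    have -> : u n (a *: v + w) - (a^*%C * f v + f w) =
        - (a^*%C * (f v - u n v) + (f w - u n w)).
      by rewrite functional_antilinear; ring.
    rewrite normcN (le_trans (le_normcD _ _))// Normc.normcM normc_conj mulrDl.
    by rewrite lerD// -?mulrA ?[sn _ * e]mulrC ?ler_wpM2l ?normc_ge0.
  have e2 : 0 < e / 2 by rewrite divr_gt0.
  have [n /(_ _ (leqnn _)) hn] := uf _ e2.
  have [v hv] := approximated_exists (u n) e2; exists v => w.
  rewrite (le_trans (normc_sub _ (u n w) _))//.
  by have := hn w; have := hv w; lra.
exists (Completion fC) => //; apply/(converges_toP (seminorm_ge0 _)) => e e0.
have e2 : 0 < e / 2 by rewrite divr_gt0.
have [n0 hn0] := uf _ e2; exists n0 => n n0n.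
apply: (@le_lt_trans _ _ (e / 2)); last by rewrite ltr_pdivrMr// ltr_pMr// ltr1n.
rewrite (seminormBC cP) norm_le_dual_bound ?(ltW e2)// => w.
exact: hn0.
Qed.

HB.instance Definition _ :=
  isHilbert.Build R completion completion_definite completion_complete.

Section Operator.
Variables (L L' : V -> V) (M : R).
Hypothesis L'_lin : linear L'.
Hypothesis LL' : forall v w, <|L' w, v|> = <|w, L v|>.
Hypothesis M_ge0 : 0 <= M.
Hypothesis L'_bound : forall w, sn (L' w) <= M * sn w.

Fact extend_approximated f v e : 0 <= e ->
  approximated f v e -> approximated (f \o L') (L v) (e * M).
Proof.
move=> e0 fv w; rewrite -LL' (le_trans (fv _))// -mulrA.
by rewrite ler_wpM2l.
Qed.

Fact extend_subproof F : (F \o L' : V -> R[i]^o) \in completion_pred.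
Proof.
apply/asboolP; split=> [a v w|e e0] /=; first by rewrite L'_lin functional_antilinear.
have M1 : 0 < M + 1 by rewrite ltr_wpDl.
have e1 : 0 < e / (M + 1) by rewrite divr_gt0.
have [v Fv] := approximated_exists F e1; exists (L v) => w.
apply: (le_trans (extend_approximated (ltW e1) Fv w)); rewrite ler_wpM2r ?sn_ge0//.
by rewrite mulrAC ler_pdivrMr// ler_wpM2l ?(ltW e0)// lerDl.
Qed.

(* Precomposition with [L'] extends [L], as [<L' w, v> = <w, L v>]. *)
Definition extend F : completion := Completion (extend_subproof F).

Lemma extend_linear : linear extend.
Proof. by move=> a F G; exact/val_inj. Qed.

Lemma extend_bound F : csn (extend F) <= M * csn F.
Proof.
apply: norm_le_dual_bound; first by rewrite mulr_ge0 ?seminorm_ge0.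
move=> w; rewrite (le_trans (dual_bound_norm F (L' w)))//.
by rewrite -mulrA mulrCA ler_wpM2l ?seminorm_ge0.
Qed.

Lemma extend_embed v : extend (embed v) = embed (L v).
Proof. by apply/val_inj/funext => w /=; rewrite LL'. Qed.

End Operator.

(** If [v] approximates [F], both sides are close to [H (L v)]: on the left [L v] approximates the
    extended [F], on the right the extended [H] takes this value at [v]. *)
Lemma extend_adjoint (L L' : V -> V) (M M' : R)
    (L_lin : linear L) (L'_lin : linear L')
    (LL' : forall v w, <|L' w, v|> = <|w, L v|>)
    (L'L : forall v w, <|L w, v|> = <|w, L' v|>)
    (M0 : 0 <= M) (M'0 : 0 <= M') (L_bound : forall w, sn (L w) <= M * sn w)
    (L'_bound : forall w, sn (L' w) <= M' * sn w) F H :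
  kform (extend L'_lin LL' M'0 L'_bound F) H =
  kform F (extend L_lin L'L M0 L_bound H).
Proof.
have [B B0 HB] := dual_bound_exists H.
have [C C0 HC] := dual_bound_exists (extend L_lin L'L M0 L_bound H).
apply: (@normc_le_eps_eq _ _ _ (M' * B + C)) => e /[dup] e0 /ltW e0' _.
have [v Fv] := approximated_exists F e0.
rewrite (le_trans (normc_sub _ (H (L v)) _))// mulrDl lerD//.
  rewrite mulrC mulrA; apply: inner_approx => //; first exact: mulr_ge0.
  exact: (extend_approximated LL' L'_bound).
by rewrite normcBC mulrC; apply: (inner_approx C0 e0' HC Fv).
Qed.

End Completion.

(** * The Gelfand--Naimark theorem *)

Section StateSum.
Context (R : realType) (A : starAlgType R).
Local Open Scope complex_scope.
Local Notation "x ** y" := (amul x y) (at level 40, left associativity).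
Implicit Types (phi : A -> R[i]) (a : R[i]) (x y : A).

(* Indexing by all functionals avoids a subtype of states. *)
Definition state_supported : {pred (A -> R[i]) -> A} := fun v =>
  `[< finite_set [set phi | v phi != 0] /\
      forall phi, v phi != 0 -> state phi >].

Fact state_supported_submod : submod_closed state_supported.
Proof.
split.
  apply/asboolP; split=> [|phi]; last by rewrite eqxx.
  by apply: (@sub_finite_set _ _ set0) => // phi /=; rewrite eqxx.
move=> a v w /asboolP[fv sv] /asboolP[fw sw].
have supp phi : (a *: v + w) phi != 0 -> v phi != 0 \/ w phi != 0.
  have [v0|v0] := eqVneq (v phi) 0; last by left.
  have [w0|w0] := eqVneq (w phi) 0; last by right.
  by rewrite -[(a *: v + w) phi]/(a *: v phi + w phi) v0 w0 scaler0 addr0 eqxx.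
apply/asboolP; split=> [|phi /supp[/sv|/sw]//].
apply: (@sub_finite_set _ _ ([set phi | v phi != 0] `|` [set phi | w phi != 0])).
  by move=> phi /supp.
by rewrite finite_setU.
Qed.

HB.instance Definition _ :=
  GRing.isSubmodClosed.Build _ _ state_supported state_supported_submod.

Record stateSum := StateSum {
  component :> (A -> R[i]) -> A;
  componentP : component \in state_supported }.

HB.instance Definition _ := [isSub for component].
HB.instance Definition _ := [Choice of stateSum by <:].
HB.instance Definition _ := [SubChoice_isSubLmodule of stateSum by <:].

Implicit Types v w : stateSum.

Lemma support_exists v : exists r : seq (A -> R[i]),
  [/\ uniq r, forall phi, phi \in r -> state phi &
      forall phi, phi \notin r -> v phi = 0].
Proof.
have /asboolP[/finite_seqP[r rE] sv] := componentP v.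
have rP phi : (phi \in r) = (v phi != 0).
  by apply/idP/idP => h; have : [set phi | v phi != 0] phi = (phi \in r) by [rewrite rE];
     rewrite /= h => hh; [rewrite hh|rewrite -hh].
exists (undup r); split; first exact: undup_uniq.
  by move=> phi; rewrite mem_undup rP => /sv.
by move=> phi; rewrite mem_undup rP negbK => /eqP.
Qed.

(** The direct sum of the GNS forms of all states, each on its own copy of [A] and not yet divided
    by its null vectors. Finite supports make the sum meaningful. *)
Definition state_form v w : R[i] :=
  \sum_(phi \in @state R A) phi (star (v phi) ** w phi).

Lemma state0 phi : state phi -> phi 0 = 0.
Proof.
case=> phi_lin _ _ _; have := phi_lin (-1) 0 0.
by rewrite scaler0 addr0 mulN1r addNr.
Qed.

Lemma state_formE v r : uniq r -> (forall phi, phi \in r -> state phi) ->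
  (forall phi, phi \notin r -> v phi = 0) ->
  forall w, state_form v w = \sum_(phi <- r) phi (star (v phi) ** w phi) /\
            state_form w v = \sum_(phi <- r) phi (star (w phi) ** v phi).
Proof.
move=> r_uniq rS r0 w.
have sumE (F : (A -> R[i]) -> R[i]) :
    (forall phi, state phi -> phi \notin r -> F phi = 0) ->
    \sum_(phi \in @state R A) F phi = \sum_(phi <- r) F phi.
  move=> F0; rewrite (fsbigE r)// [LHS]big_seq_cond [RHS]big_seq.
  by apply: eq_bigl => phi; case: (boolP (phi \in r)) => //= /rS /mem_set.
split; apply: sumE => phi /state0 phi0 /r0 ->; first by rewrite star0 amul0l.
by rewrite amul0r.
Qed.

Fact state_form_linear v : scalar (state_form v).
Proof.
move=> a w w'; have [r [r_uniq rS r0]] := support_exists v.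
have vE u := (state_formE r_uniq rS r0 u).1.
rewrite !vE mulr_sumr -big_split/=; apply: eq_big_seq => phi /rS[phi_lin _ _ _].
by rewrite -phi_lin -amulZr -amulDr.
Qed.

Fact state_form_herm v w : state_form w v = (state_form v w)^*%C.
Proof.
have [r [r_uniq rS r0]] := support_exists v.
have [-> ->] := state_formE r_uniq rS r0 w.
rewrite rmorph_sum /=; apply: eq_big_seq => phi /rS[_ phiS _ _].
by rewrite -phiS starM starK.
Qed.

Fact state_form_ge0 v : 0 <= state_form v v.
Proof.
have [r [r_uniq rS r0]] := support_exists v.
rewrite (state_formE r_uniq rS r0 v).1 big_seq; apply: sumr_ge0 => phi /rS[_ _ + _].
exact.
Qed.

HB.instance Definition _ :=
  hasHermitianForm.Build R stateSum state_form_linear state_form_herm.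
HB.instance Definition _ := isPreHilbert.Build R stateSum state_form_ge0.

Fact left_mul_subproof x v : (fun phi => x ** v phi) \in state_supported.
Proof.
have /asboolP[fv sv] := componentP v.
have supp phi : x ** v phi != 0 -> v phi != 0.
  by apply: contra_neq => ->; rewrite amul0r.
apply/asboolP; split=> [|phi /supp/sv//].
exact: (sub_finite_set supp).
Qed.

Definition left_mul x v : stateSum := StateSum (left_mul_subproof x v).

Lemma left_mul_linear x : linear (left_mul x).
Proof.
by move=> a v w; apply/val_inj/funext => phi /=; rewrite amulDr amulZr.
Qed.

Lemma left_mul_adjoint x v w :
  kform (left_mul (star x) w) v = kform w (left_mul x v).
Proof. by apply: eq_fsbigr => phi _ /=; rewrite starM starK amulA. Qed.

Lemma delta_subproof phi x : state phi ->
  (fun psi => if psi == phi then x else 0) \in state_supported.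
Proof.
move=> phiS; have supp psi : (if psi == phi then x else 0) != 0 -> psi = phi.
  by have [//|_] := eqVneq psi phi; rewrite /= eqxx.
apply/asboolP; split=> [|psi /supp ->//].
exact: (@sub_finite_set _ _ [set phi]).
Qed.

Definition delta phi x (phiS : state phi) : stateSum :=
  StateSum (delta_subproof x phiS).

Lemma delta_form phi x (phiS : state phi) :
  kform (delta x phiS) (delta x phiS) = phi (star x ** x).
Proof.
have [||psi|dE _] := @state_formE (delta x phiS) [:: phi] _ _ _ (delta x phiS).
- by [].
- by move=> psi; rewrite inE => /eqP ->.
- by rewrite inE /= => /negPf ->.
by rewrite [LHS]dE big_seq1 /= eqxx.
Qed.

Lemma left_mul_delta x phi y (phiS : state phi) :
  left_mul x (delta y phiS) = delta (x ** y) phiS.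
Proof.
by apply/val_inj/funext => psi /=; case: ifP => // _; rewrite amul0r.
Qed.

Section Representation.
Variable N : A -> R.
Hypothesis HN : banach_algebra_norm N.
Hypothesis NC : forall x, N (star x ** x) = N x ^+ 2.

Local Notation sn := (seminorm (@kform R stateSum)).
Local Notation csn := (seminorm (@kform R (completion stateSum))).

Lemma left_mul_bound x v : sn (left_mul x v) <= N x * sn v.
Proof.
rewrite -(@ler_pXn2r _ 2) ?nnegrE ?mulr_ge0 ?seminorm_ge0 ?(bnorm_ge0 HN)//.
rewrite exprMn -lecR -(sipxx (preHilbertP stateSum)).
have -> : (N x ^+ 2 * sn v ^+ 2)%:C = (N x ^+ 2)%:C * kform v v.
  by rewrite (sipxx (preHilbertP stateSum)) -rmorphM.
have [r [r_uniq rS r0]] := support_exists v.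
have xr0 phi : phi \notin r -> left_mul x v phi = 0.
  by move=> /r0 /= ->; rewrite amul0r.
rewrite [leLHS](state_formE r_uniq rS xr0 _).1 [X in _ * X](state_formE r_uniq rS r0 _).1.
rewrite mulr_sumr !big_seq; apply: ler_sum => phi /rS phiS.
exact: (state_bound HN NC).
Qed.

Lemma left_mul_star_adjoint x v w :
  kform (left_mul x w) v = kform w (left_mul (star x) v).
Proof. by rewrite -{1}[x]starK left_mul_adjoint. Qed.

Lemma left_mul_star_bound x v : sn (left_mul (star x) v) <= N x * sn v.
Proof. by rewrite -(cnorm_star HN NC) left_mul_bound. Qed.

(** The extension of [left_mul x]: as [extend] precomposes with the adjoint, its argument is
    multiplication by [star x]. *)
Definition gns x : completion stateSum -> completion stateSum :=
  extend (left_mul_linear (star x)) (left_mul_adjoint x) (bnorm_ge0 HN x)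
    (left_mul_star_bound x).

Lemma gns_adjoint x F G : kform (gns (star x) F) G = kform F (gns x G).
Proof.
rewrite -(extend_adjoint (left_mul_linear (star x)) (left_mul_linear x)
  (left_mul_star_adjoint x) (left_mul_adjoint x) (bnorm_ge0 HN x)
  (bnorm_ge0 HN x) (left_mul_star_bound x) (left_mul_bound x)).
by congr (kform _ _); apply/val_inj/funext => w /=; rewrite starK.
Qed.

Lemma gns_linear : linear gns.
Proof.
move=> a x y; apply/funext => F; apply/val_inj/funext => w.
have -> : val (gns (a *: x + y) F) w = F (a^*%C *: left_mul (star x) w + left_mul (star y) w).
  congr (F _); apply/val_inj/funext => phi.
  by rewrite /= star_antilinear amulDl amulZl.
by rewrite functional_antilinear conjcK.
Qed.

Lemma gns1 : gns aone = id.
Proof.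
apply/funext => F; apply/val_inj/funext => w /=; congr (F _).
by apply/val_inj/funext => phi; rewrite /= star1 amul1l.
Qed.

Lemma gnsM x y : gns (x ** y) = gns x \o gns y.
Proof.
apply/funext => F; apply/val_inj/funext => w /=; congr (F _).
by apply/val_inj/funext => phi; rewrite /= starM amulA.
Qed.

(** The test vector is the unit placed at a state that norms [star x ** x]. Its norm is at most [1]
    by [phi aone <= 1], and its image has norm [N x]. *)
Lemma gns_norm_ge x M : 0 <= M -> (forall F, csn (gns x F) <= M * csn F) -> N x <= M.
Proof.
move=> M0 xM; have [phi phiS phix] := state_exists HN NC x.
have := xM (embed (delta aone phiS)).
rewrite /gns extend_embed !embed_norm left_mul_delta amul1r /seminorm !delta_form.
rewrite phix star1 amul1l /= sqrtr_sqr ger0_norm ?(bnorm_ge0 HN)//.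
move=> h; apply: (le_trans h); rewrite ler_piMr//.
case: phiS => _ _ _; rewrite lecE /= => /andP[_].
by rewrite -(ler_sqrt _ ler01) sqrtr1.
Qed.

End Representation.

End StateSum.

(** The last two clauses say that [N x] is the operator norm of [rho x], expressed as a least bound
    to avoid suprema. *)
Theorem gelfand_naimark (R : realType) (A : starAlgType R) (N : A -> R) :
  banach_algebra_norm N -> (forall x, N (amul (star x) x) = N x ^+ 2) ->
  exists (H : hilbertType R) (rho : A -> (H -> H)),
    [/\ linear rho /\ (forall x, linear (rho x)),
        rho aone = id /\ {morph rho : x y / amul x y >-> x \o y},
        forall x u v, kform (rho (star x) u) v = kform u (rho x v),
        forall x u, seminorm kform (rho x u) <= N x * seminorm kform u
      & forall x (M : R), 0 <= M ->
          (forall u, seminorm kform (rho x u) <= M * seminorm kform u) ->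
          N x <= M].
Proof.
move=> HN NC; exists (completion (stateSum A)), (gns HN NC); split.
- split; first exact: gns_linear.
  by move=> x; exact: extend_linear.
- by split; [exact: gns1|exact: gnsM].
- exact: gns_adjoint.
- by move=> x; exact: extend_bound.
- by move=> x M; exact: gns_norm_ge.
Qed.

(** * Krein spaces *)

Section FundamentalSymmetry.
Context (R : realType) (K : kreinSpaceType R).
Local Open Scope complex_scope.
Local Notation normc := (@Normc.normc R).
Implicit Types (x y z : K) (J T : K -> K).

Lemma kform_hermitian : hermitian_form (@kform R K).
Proof. by split; [exact: kform_linear|exact: kform_herm]. Qed.

Local Notation kH := kform_hermitian.

Lemma hnorm_ge0 J x : 0 <= hnorm J x. Proof. exact: sqrtr_ge0. Qed.

Section Decomposition.
Variables (J : K -> K) (Kp Km : {pred K}).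
Hypothesis KpKm : fundamental_decomposition Kp Km.
Hypothesis JE : {in Kp & Km, forall x y, J (x + y) = x - y}.

Let Kp_submod : submod_closed Kp. Proof. by case: KpKm => -[]. Qed.
Let Km_submod : submod_closed Km. Proof. by case: KpKm => _ []. Qed.

Let subN (S : {pred K}) : submod_closed S -> {in S, forall x, - x \in S}.
Proof.
by case=> S0 S_lin x xS; rewrite -scaleN1r -[_ *: _]addr0 S_lin.
Qed.

Let subB (S : {pred K}) : submod_closed S -> {in S &, forall x y, x - y \in S}.
Proof.
by case=> S0 S_lin x y xS yS; rewrite addrC -scaleN1r S_lin.
Qed.

Let orth : {in Kp & Km, forall x y, kform x y = 0}.
Proof. by case: KpKm. Qed.

Let orthC : {in Kp & Km, forall x y, kform y x = 0}.
Proof. by move=> x y xp ym; rewrite kform_herm orth// conjc0. Qed.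

Lemma decomposition_exists z : exists x y, [/\ x \in Kp, y \in Km & z = x + y].
Proof. by case: KpKm. Qed.

Lemma symmetry_linear a x y : J (a *: x + y) = a *: J x + J y.
Proof.
have [xp [xm [xpP xmP ->]]] := decomposition_exists x.
have [yp [ym [ypP ymP ->]]] := decomposition_exists y.
rewrite scalerDr addrACA !JE//; first by module R[i] K.
- by case: Kp_submod => _ +; apply.
- by case: Km_submod => _ +; apply.
Qed.

Lemma symmetryK x : J (J x) = x.
Proof.
have [xp [xm [xpP xmP ->]]] := decomposition_exists x.
by rewrite [J (_ + _)]JE// JE ?opprK// subN.
Qed.

Lemma symmetry_formE xp xm yp ym : xp \in Kp -> xm \in Km -> yp \in Kp -> ym \in Km ->
  kform (xp + xm) (J (yp + ym)) = kform xp yp - kform xm ym.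
Proof.
move=> xpP xmP ypP ymP; rewrite JE// (formDl kH) !(formBr kH).
by rewrite (orth xpP ymP) (orthC ypP xmP) subr0 sub0r.
Qed.

Let nneg (S : {pred K}) (g : K -> K -> R[i]) x :
  g 0 0 = 0 -> hilbert_subspace g S -> x \in S -> 0 <= g x x.
Proof.
move=> g0 [_ g_pos _] xS; have [->|x0] := eqVneq x 0; first by rewrite g0.
by rewrite ltW ?g_pos.
Qed.

Let kform00 : kform (0 : K) 0 = 0. Proof. by rewrite (form0r kH). Qed.

Let nnegp x : x \in Kp -> 0 <= kform x x.
Proof. by case: KpKm => + _ _ _ _; exact: nneg. Qed.

Let nnegm x : x \in Km -> 0 <= - kform x x.
Proof.
case: KpKm => _ + _ _ _; apply: (@nneg _ (fun x y => - kform x y)).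
by rewrite kform00 oppr0.
Qed.

Lemma symmetry_semi_inner : semi_inner_product (fun x y => kform x (J y)).
Proof.
split; [split=> [x a y z|x y]|move=> x].
- by rewrite symmetry_linear (formDr kH) (formZr kH).
- have [xp [xm [xpP xmP ->]]] := decomposition_exists x.
  have [yp [ym [ypP ymP ->]]] := decomposition_exists y.
  by rewrite !symmetry_formE// (kform_herm xp yp) (kform_herm xm ym) rmorphB.
- have [xp [xm [xpP xmP ->]]] := decomposition_exists x.
  by rewrite symmetry_formE// addr_ge0 ?nnegp ?nnegm.
Qed.

Lemma hnorm_symmetry x : hnorm J (J x) = hnorm J x.
Proof. by rewrite /hnorm symmetryK kform_herm; case: (kform x (J x)). Qed.

(** Cauchy--Schwarz for the Hilbert form, applied to [x] and [J y]. *)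
Lemma normc_kform_le x y : normc (kform x y) <= hnorm J x * hnorm J y.
Proof.
rewrite -(hnorm_symmetry y) -{1}[y]symmetryK.
exact: (cauchy_schwarz symmetry_semi_inner).
Qed.

Lemma hnorm_decomposition xp xm : xp \in Kp -> xm \in Km ->
  hnorm J xp <= hnorm J (xp + xm) /\ hnorm J xm <= hnorm J (xp + xm).
Proof.
move=> xpP xmP; have := nnegp xpP; have := nnegm xmP; rewrite !lecE /=.
move=> /andP[_ pm] /andP[_ pp].
have Re_sub (u v : R[i]) : complex.Re (u - v) = complex.Re u - complex.Re v.
  by case: u v => ? ? [].
have K0p : 0 \in Kp by case: Kp_submod. have K0m : 0 \in Km by case: Km_submod.
have hp := symmetry_formE xpP K0m xpP K0m; have hm := symmetry_formE K0p xmP K0p xmP.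
rewrite !addr0 kform00 subr0 in hp; rewrite !add0r kform00 in hm.
rewrite raddfN /= in pm.
by split; rewrite /hnorm ler_sqrt ?symmetry_formE// ?hp ?hm ?Re_sub//=; lra.
Qed.

Lemma hnorm_eq0 x : hnorm J x = 0 -> x = 0.
Proof.
have [xp [xm [xpP xmP ->]]] := decomposition_exists x => x0.
have [[_ ppos _] [_ mpos _] _ _ _] := KpKm.
have K0p : 0 \in Kp by case: Kp_submod. have K0m : 0 \in Km by case: Km_submod.
have [hp hm] := hnorm_decomposition xpP xmP; rewrite x0 in hp hm.
have -> : xp = 0.
  apply: contraTeq hp => /(ppos _ xpP) p0; rewrite -ltNge /hnorm sqrtr_gt0.
  have := symmetry_formE xpP K0m xpP K0m; rewrite !addr0 kform00 subr0 => ->.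
  by move: p0; rewrite ltcE => /andP[].
have -> : xm = 0.
  apply: contraTeq hm => /(mpos _ xmP) m0; rewrite -ltNge /hnorm sqrtr_gt0.
  have := symmetry_formE K0p xmP K0p xmP; rewrite !add0r kform00 sub0r => ->.
  by move: m0; rewrite ltcE => /andP[].
by rewrite addr0.
Qed.

(** On [Kp] and [Km] the norm agrees with the given one, and both projections are contractive, so a
    Cauchy sequence splits into two. *)
Lemma hnorm_complete : complete_on (hnorm J) predT.
Proof.
move=> u _ uC; have gP := symmetry_semi_inner.
have /choice[p /choice[m pmP]] : forall n, exists x y, [/\ x \in Kp, y \in Km & u n = x + y].
  by move=> n; exact: decomposition_exists.
have pP n : p n \in Kp by case: (pmP n).
have mP n : m n \in Km by case: (pmP n).
have uE n : u n = p n + m n by case: (pmP n).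
have uB k n : u k - u n = (p k - p n) + (m k - m n).
  by rewrite !uE; module R[i] K.
have K0p : 0 \in Kp by case: Kp_submod. have K0m : 0 \in Km by case: Km_submod.
have pnorm x : x \in Kp -> Num.sqrt (complex.Re (kform x x)) = hnorm J x.
  move=> xP; have := symmetry_formE xP K0m xP K0m.
  by rewrite /hnorm !addr0 kform00 subr0 => ->.
have mnorm x : x \in Km -> Num.sqrt (complex.Re (- kform x x)) = hnorm J x.
  move=> xP; have := symmetry_formE K0p xP K0p xP.
  by rewrite /hnorm !add0r kform00 sub0r => ->.
have [[_ _ Kp_compl] [_ _ Km_compl] _ _ _] := KpKm.
have [|lp lpP /(converges_toP (fun=> sqrtr_ge0 _)) pl] := Kp_compl p pP.
  move=> e /uC[n0 hn0]; exists n0 => k n n0k n0n.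
  rewrite pnorm; last exact: subB.
  apply: le_lt_trans (hn0 k n n0k n0n); rewrite uB.
  by apply: (hnorm_decomposition _ _).1; exact: subB.
have [|lm lmP /(converges_toP (fun=> sqrtr_ge0 _)) ml] := Km_compl m mP.
  move=> e /uC[n0 hn0]; exists n0 => k n n0k n0n.
  rewrite mnorm; last exact: subB.
  apply: le_lt_trans (hn0 k n n0k n0n); rewrite uB.
  by apply: (hnorm_decomposition _ _).2; exact: subB.
exists (lp + lm) => //; apply/(converges_toP (hnorm_ge0 J)) => e e0.
have e2 : 0 < e / 2 by rewrite divr_gt0.
have [n0 hn0] := pl _ e2; have [n1 hn1] := ml _ e2.
exists (maxn n0 n1) => n; rewrite geq_max => /andP[/hn0 h0 /hn1 h1].
rewrite pnorm ?subB// in h0; rewrite mnorm ?subB// in h1.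
have -> : u n - (lp + lm) = (p n - lp) + (m n - lm) by rewrite uE; module R[i] K.
have hD x y : hnorm J (x + y) <= hnorm J x + hnorm J y by exact: (seminormD gP).
by have := hD (p n - lp) (m n - lm); lra.
Qed.

End Decomposition.

Lemma fundamental_symmetryP J : fundamental_symmetry J ->
  [/\ semi_inner_product (fun x y => kform x (J y)),
      forall x, hnorm J (J x) = hnorm J x,
      forall x y, normc (kform x y) <= hnorm J x * hnorm J y,
      forall x, hnorm J x = 0 -> x = 0
    & complete_on (hnorm J) predT].
Proof.
move=> [Kp [Km [KpKm JE]]]; split.
- exact: symmetry_semi_inner KpKm JE.
- exact: hnorm_symmetry KpKm JE.
- exact: normc_kform_le KpKm JE.
- exact: hnorm_eq0 KpKm JE.
- exact: hnorm_complete KpKm JE.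
Qed.

(* Banach--Steinhaus by a gliding hump: if no constant works, pick [x n] with
   [hnorm J1 (x n) = 1] and [hnorm J2 (x n) <= 3^-n / n.+1] and build [y] as a
   series of terms [+- 3^-n J1 (x n)], the signs keeping [|<x n, y>|] above
   [3^-n / 2]; this contradicts [|<x n, y>| <= hnorm J2 (x n) * hnorm J2 y]. *)
Lemma hnorm_equivalent J1 J2 : fundamental_symmetry J1 ->
  fundamental_symmetry J2 ->
  exists2 C : R, 0 <= C & forall x, hnorm J1 x <= C * hnorm J2 x.
Proof.
move=> /fundamental_symmetryP[P1 J1norm bnd1 _ compl1].
move=> /fundamental_symmetryP[P2 _ bnd2 _ _].
apply: contrapT => noC.
have h1_ge0 := hnorm_ge0 J1; have h2_ge0 := hnorm_ge0 J2.
pose q n : R := 3 ^- n.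
have q0 n : 0 < q n by rewrite invr_gt0 exprn_gt0.
have qS n : q n.+1 = q n / 3 by rewrite /q exprSr invfM.
have /choice[x xP] : forall n : nat, exists x,
    hnorm J1 x = 1 /\ hnorm J2 x * n.+1%:R <= q n.
  move=> n; apply: contrapT => nox; apply: noC.
  have C0 : 0 <= n.+1%:R / q n by rewrite divr_ge0// ltW.
  exists (n.+1%:R / q n) => // x; have [x0|x0] := eqVneq (hnorm J1 x) 0.
    by rewrite x0 mulr_ge0.
  have {}x0 : 0 < hnorm J1 x by rewrite lt_neqAle eq_sym x0 h1_ge0.
  rewrite leNgt; apply/negP => hx; apply: nox.
  exists ((hnorm J1 x)^-1%:C *: x); split.
    rewrite -[hnorm _ _]/(seminorm (fun x y => kform x (J1 y)) _) (seminormZ P1).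
    by rewrite normc_real ger0_norm ?invr_ge0// mulVf// gt_eqF.
  rewrite -[hnorm _ _]/(seminorm (fun x y => kform x (J2 y)) _) (seminormZ P2).
  rewrite normc_real ger0_norm ?invr_ge0// -mulrA ler_pdivrMl//.
  rewrite -[seminorm _ _]/(hnorm J2 _).
  by rewrite mulrAC ltr_pdivrMr// in hx; rewrite mulrC ltW.
pose s n y : R := if q n <= normc (kform (x n) y + (q n)%:C) then q n else - q n.
pose fix y n : K := if n is m.+1 then y m + (s m (y m))%:C *: J1 (x m) else 0.
have form1 n : kform (x n) (J1 (x n)) = 1.
  by rewrite [LHS](sipxx P1) -[seminorm _ _]/(hnorm J1 _) (xP n).1 expr1n.
have sq n z : `|s n z| = q n by rewrite /s; case: ifP; rewrite ?normrN ger0_norm ?(ltW (q0 n)).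
(* The numbers [a + q n] and [a - q n] differ by [2 * q n], so one of them has modulus at least
   [q n]; [s] selects it. *)
have hump n : q n <= normc (kform (x n) (y n.+1)).
  rewrite /= (formDr kH) (formZr kH) form1 mulr1 /s; case: ifPn => //.
  rewrite -ltNge => h; set a := kform _ _ in h *.
  have := normc_sub (a + (q n)%:C) 0 (a + (- q n)%:C); rewrite subr0 sub0r normcN.
  have -> : a + (q n)%:C - (a + (- q n)%:C) = (2 * q n)%:C by ring.
  rewrite normc_real ger0_norm ?mulr_ge0 ?(ltW (q0 n))//; lra.
have tail n k : hnorm J1 (y (k + n)%N - y n) <= (q n - q (k + n)%N) * (3 / 2).
  elim: k => [|k ih]; first by rewrite !subrr mul0r [hnorm _ _](seminorm0 P1).
  rewrite addSn; apply: (le_trans (seminorm_sub P1 _ (y (k + n)%N) _)).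
  rewrite /= [y _ + _]addrC addrK (seminormZ P1) normc_real sq.
  rewrite -[seminorm _ (J1 _)]/(hnorm J1 _) J1norm (xP _).1 mulr1.
  rewrite qS; move: ih; rewrite -[seminorm _ _]/(hnorm J1 _); lra.
have q_small e : 0 < e -> exists n, q n < e.
  move=> e0; have [n _ /(_ n (leqnn n)) /= hn] := near_infty_natSinv_lt (PosNum e0).
  exists n; apply: le_lt_trans hn.
  by rewrite lef_pV2 ?posrE ?exprn_gt0// -natrX ler_nat ltn_expl.
have tail0 m n : (n <= m)%N -> hnorm J1 (y m - y n) <= q n * (3 / 2).
  move=> /subnK <-; apply: (le_trans (tail _ _)); rewrite ler_wpM2r//.
  by rewrite gerBl ltW.
have hsub u v w : hnorm J1 (u - w) <= hnorm J1 (u - v) + hnorm J1 (v - w).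
  exact: (seminorm_sub P1).
have hC u v : hnorm J1 (u - v) = hnorm J1 (v - u) by exact: (seminormBC P1).
have [|z _ /(converges_toP h1_ge0) yz] := compl1 y (fun=> isT).
  move=> e e0; have [|n0 qn0] := q_small (e / 3); first exact: divr_gt0.
  exists n0 => m n /tail0 hm /tail0 hn.
  by have := hsub (y m) (y n0) (y n); rewrite (hC (y n0)); lra.
(* Here the ratio [3] matters: the terms after the hump add up to at most
   [q n.+1 * (3 / 2) = q n / 2], half of its height. *)
have hz n : hnorm J1 (y n.+1 - z) <= q n / 2.
  rewrite -subr_le0; apply: (@le0_of_le_eps _ _ 1) => e e0 _.
  have [n1 /(_ (maxn n1 n.+1) (leq_maxl _ _)) /ltW hn1] := yz _ e0.
  have := tail0 (maxn n1 n.+1) n.+1 (leq_maxr _ _); rewrite qS.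
  by have := hsub (y n.+1) (y (maxn n1 n.+1)) z; rewrite (hC (y n.+1) (y _)); lra.
have low n : q n / 2 <= normc (kform (x n) z).
  have := bnd1 (x n) (y n.+1 - z); rewrite (xP n).1 mul1r (formBr kH).
  have := normc_sub (kform (x n) (y n.+1)) (kform (x n) z) 0; rewrite !subr0.
  by have := hump n; have := hz n; lra.
(* For this [n], the upper bound [q n / n.+1 * hnorm J2 z] on the modulus of [<x n, z>] falls below
   the lower bound [q n / 2]. *)
pose n := Num.bound (2 * hnorm J2 z).
have nz : 2 * hnorm J2 z < n.+1%:R.
  by apply: (lt_trans (archi_boundP _)); rewrite ?mulr_ge0// ltr_nat.
have := ler_wpM2r (h2_ge0 z) (xP n).2.
have := le_trans (low n) (bnd2 (x n) z).
have n0 : 0 < n.+1%:R :> R by [].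
move: nz n0 (q0 n) (h2_ge0 z) (h2_ge0 (x n)).
move: n.+1%:R (hnorm J2 z) (hnorm J2 (x n)) (q n) => b c d r bc b0 r0 c0 d0 h1 h2.
have h3 := ler_wpM2r (ltW b0) h1.
have : r * (2 * c) < r * b by rewrite ltr_pM2l.
by nra.
Qed.


Lemma hnormZr J : fundamental_symmetry J -> forall (r : R) x, 0 <= r ->
  hnorm J (r%:C *: x) = r * hnorm J x.
Proof.
move=> /fundamental_symmetryP[P _ _ _ _] r x r0.
by rewrite [LHS](seminormZ P) normc_real ger0_norm.
Qed.

Lemma linear_fun0 T : linear T -> T 0 = 0.
Proof.
by move=> T_lin; have := T_lin (-1) 0 0; rewrite scaler0 addr0 scaleN1r addNr.
Qed.

Lemma linear_funZ T : linear T -> forall a x, T (a *: x) = a *: T x.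
Proof.
by move=> T_lin a x; have := T_lin a x 0; rewrite (linear_fun0 T_lin) !addr0.
Qed.

Lemma bounded_of_continuous J T : fundamental_symmetry J -> linear T ->
  krein_continuous T ->
  exists2 M : R, 0 <= M & forall x, hnorm J (T x) <= M * hnorm J x.
Proof.
move=> Jf T_lin Tc; have [d d0 hd] := Tc J Jf 0 1 ltr01.
exists (2 / d); first by rewrite divr_ge0// ltW.
move=> x; rewrite leNgt; apply/negP => hx.
have x0 : 0 <= 2 / d * hnorm J x by rewrite mulr_ge0 ?hnorm_ge0// divr_ge0// ltW.
have Tx0 := le_lt_trans x0 hx.
have r0 : 0 <= (hnorm J (T x))^-1 by rewrite invr_ge0 hnorm_ge0.
have := hd ((hnorm J (T x))^-1%:C *: x).
rewrite (linear_fun0 T_lin) !subr0 (linear_funZ T_lin) !hnormZr// mulVf ?gt_eqF// ltxx.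
move=> h; suff /h : (hnorm J (T x))^-1 * hnorm J x < d by [].
rewrite ltr_pdivrMl//; move: hx; rewrite mulrAC ltr_pdivrMr//.
by have := hnorm_ge0 J x; nra.
Qed.

(** Continuity is required for every fundamental symmetry; a bound for one of them is transported by
    the two constants of [hnorm_equivalent]. *)
Lemma continuous_of_bounded J T (M : R) : fundamental_symmetry J -> linear T ->
  0 <= M -> (forall x, hnorm J (T x) <= M * hnorm J x) -> krein_continuous T.
Proof.
move=> Jf T_lin M0 TM J' J'f x e e0.
have [C C0 hC] := hnorm_equivalent Jf J'f.
have [C' C'0 hC'] := hnorm_equivalent J'f Jf.
have L0 : 0 <= C' * (M * C) by rewrite !mulr_ge0.
have L1 : 0 < C' * (M * C) + 1 by rewrite ltr_wpDl.
exists (e / (C' * (M * C) + 1)); first by rewrite divr_gt0.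
move=> y; rewrite ltr_pdivlMr// => hy; apply: le_lt_trans hy.
have -> : T y - T x = T (y - x).
  by have := T_lin (-1) x y; rewrite !scaleN1r [- x + y]addrC [- T x + _]addrC.
apply: (le_trans (hC' _)); have h1 := ler_wpM2l C'0 (TM (y - x)).
have h2 := ler_wpM2l C'0 (ler_wpM2l M0 (hC (y - x))).
by have := hnorm_ge0 J' (y - x); lra.
Qed.

(** Continuity makes the set in [opnorm] bounded; otherwise [sup] would be its default value [0]. *)
Lemma hnorm_le_opnorm J T : fundamental_symmetry J -> linear T ->
  krein_continuous T -> forall x, hnorm J (T x) <= opnorm J T * hnorm J x.
Proof.
move=> Jf T_lin Tc x; have [M M0 TM] := bounded_of_continuous Jf T_lin Tc.
have ball y : hnorm J y <= 1 -> hnorm J (T y) <= opnorm J T.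
  move=> y1; apply: ub_le_sup; last by exists y.
  by exists M => _ [z z1 <-]; rewrite (le_trans (TM z))// ler_piMr.
have [x0|x0] := eqVneq (hnorm J x) 0.
  by rewrite x0 mulr0; have := TM x; rewrite x0 mulr0.
have {}x0 : 0 < hnorm J x by rewrite lt_neqAle eq_sym x0 hnorm_ge0.
have := ball ((hnorm J x)^-1%:C *: x).
rewrite (linear_funZ T_lin) !hnormZr// ?invr_ge0 ?hnorm_ge0// mulVf ?gt_eqF//.
by rewrite ler_pdivrMl// mulrC; exact.
Qed.

End FundamentalSymmetry.

(** * Closedness of the range of an isometric representation *)

Section ClosedRange.
Context (R : realType) (A : starAlgType R) (N : A -> R) (K : kreinSpaceType R).
Variables (J : K -> K) (pi : A -> K -> K).
Hypothesis HN : banach_algebra_norm N.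
Hypothesis Jf : fundamental_symmetry J.
Hypothesis pi_lin : linear pi.
Hypothesis pi_op_lin : forall x, linear (pi x).
Hypothesis pi_le : forall x v, hnorm J (pi x v) <= N x * hnorm J v.
Hypothesis pi_ge : forall x M, 0 <= M ->
  (forall v, hnorm J (pi x v) <= M * hnorm J v) -> N x <= M.

Lemma operator_continuous x : cont_linear_operators K (pi x).
Proof.
split; first exact: pi_op_lin.
exact: (continuous_of_bounded Jf (@pi_op_lin x) (bnorm_ge0 HN x) (@pi_le x)).
Qed.

Let piB x y v : pi (x - y) v = pi x v - pi y v.
Proof.
have -> : x - y = -1 *: y + x by module R[i] A.
by rewrite pi_lin -[LHS]/(-1 *: pi y v + pi x v); module R[i] K.
Qed.

Lemma range_closed : closed_operator_set (range pi).
Proof.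
move=> J' J'f T [T_lin Tc] Tcl.
have [P _ _ hdef _] := fundamental_symmetryP Jf.
have [C C0 hC] := hnorm_equivalent Jf J'f.
have [C' C'0 hC'] := hnorm_equivalent J'f Jf.
(* The hypothesis speaks of [J'], the isometry of [pi] of [J]. Changing the norm of both argument
   and value costs the factor [C * C'], and the added [1] keeps the denominator positive. *)
have near_op e : 0 < e -> exists x, forall v,
    hnorm J (T v - pi x v) <= e * hnorm J v.
  move=> e0; have CC : 0 < C * C' + 1 by rewrite ltr_wpDl ?mulr_ge0.
  have [|_ [x _ <-] hx] := Tcl (e / (C * C' + 1)); first by rewrite divr_gt0.
  exists x => v.
  have D_lin : linear (T - pi x).
    move=> a u w; rewrite -[LHS]/(T (a *: u + w) - pi x (a *: u + w)).
    rewrite -[RHS]/(a *: (T u - pi x u) + (T w - pi x w)) T_lin pi_op_lin.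
    by module R[i] K.
  have D_cont : krein_continuous (T - pi x).
    have [M M0 TM] := bounded_of_continuous Jf T_lin Tc.
    apply: (continuous_of_bounded Jf D_lin (addr_ge0 M0 (bnorm_ge0 HN x))) => w.
    rewrite -[(T - pi x) w]/(T w - pi x w) mulrDl.
    exact: (le_trans (seminormB P _ _) (lerD (TM w) (pi_le x w))).
  have := hnorm_le_opnorm J'f D_lin D_cont v.
  rewrite -[(T - pi x) v]/(T v - pi x v) => hop.
  have h1 := ler_wpM2r (hnorm_ge0 J' v) (ltW hx).
  have h2 := le_trans (hC _) (ler_wpM2l C0 (le_trans hop h1)).
  apply: (le_trans h2).
  have h3 := ler_wpM2l C0 (ler_wpM2l (divr_ge0 (ltW e0) (ltW CC)) (hC' v)).
  apply: (le_trans h3); set D := _ + 1 in CC *.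
  have -> : C * (e / D * (C' * hnorm J v)) = e * hnorm J v * (C * C' / D) by ring.
  rewrite ler_piMr ?mulr_ge0 ?hnorm_ge0 ?(ltW e0)//.
  by rewrite ler_pdivrMr// mul1r lerDl.
have /choice[x xP] : forall n : nat, exists x, forall v,
    hnorm J (T v - pi x v) <= n.+1%:R^-1 * hnorm J v.
  by move=> n; apply: near_op; rewrite invr_gt0.
have hsub u v w : hnorm J (u - w) <= hnorm J (u - v) + hnorm J (v - w).
  exact: (seminorm_sub P).
have hBC u v : hnorm J (u - v) = hnorm J (v - u) by exact: (seminormBC P).
have [l _ /(converges_toP (bnorm_ge0 HN)) xl] : exists2 l, l \in predT & converges_to N x l.
  case: HN => _ _ _ _; apply=> // e e0.
  have [n0 _ hn0] := near_infty_natSinv_lt (PosNum (divr_gt0 e0 (ltr0n R 2))).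
  exists n0 => m n /hn0 /= hm /hn0 /= hn.
  apply: (@le_lt_trans _ _ (m.+1%:R^-1 + n.+1%:R^-1)); last first.
    by move: m.+1%:R^-1 n.+1%:R^-1 hm hn => a b; lra.
  apply: pi_ge => [|v]; first by rewrite addr_ge0.
  rewrite piB (le_trans (hsub _ (T v) _))// mulrDl lerD// ?xP// hBC.
  exact: xP.
exists l => //; apply/funext => v; apply/eqP; rewrite -subr_eq0; apply/eqP.
apply: hdef; apply/eqP; rewrite eq_le hnorm_ge0 andbT.
apply: (@le0_of_le_eps _ _ (2 * hnorm J v)) => e e0 _.
have [n0 _ hn0'] := near_infty_natSinv_lt (PosNum e0).
have [n1 hn1] := xl _ e0; pose n := maxn n0 n1.
have /= /ltW h0 := hn0' n (leq_maxl _ _).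
have /ltW h1 := hn1 n (leq_maxr _ _).
have h2 := le_trans (xP n v) (ler_wpM2r (hnorm_ge0 J v) h0).
have h3 := le_trans (pi_le (x n - l) v) (ler_wpM2r (hnorm_ge0 J v) h1).
rewrite piB in h3; rewrite hBC; have := hsub (T v) (pi (x n) v) (pi l v).
by lra.
Qed.

End ClosedRange.

(** * Representation of Krein C*-algebras *)

Definition swap_double (R : realType) (H : hilbertType R) : Type := (H * H)%type.

Section SwapDouble.
Context (R : realType) (H : hilbertType R).
Local Open Scope complex_scope.
Local Notation D := (swap_double H).
Implicit Types p q : D.

HB.instance Definition _ := GRing.Lmodule.on D.

Definition swap_form p q : R[i] := kform p.1 q.2 + kform p.2 q.1.

Local Notation hP := (preHilbertP H).

Fact swap_form_linear p : scalar (swap_form p).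
Proof.
move=> a q q'; rewrite /swap_form /= !(formDr hP.1) !(formZr hP.1).
by ring.
Qed.

Fact swap_form_herm p q : swap_form q p = (swap_form p q)^*%C.
Proof.
rewrite /swap_form (kform_herm p.2 q.1) (kform_herm p.1 q.2) addrC.
by rewrite rmorphD.
Qed.

HB.instance Definition _ :=
  hasHermitianForm.Build R D swap_form_linear swap_form_herm.

(** The diagonal for [s = 1] and the antidiagonal for [s = -1], the positive and negative parts of
    the decomposition. On them the swap form of [p] with itself is [2 s <p.1|p.1>], so completeness
    comes from [H]. *)
Definition graph (s : R) : {pred D} := fun p => p.2 == s%:C *: p.1.

Lemma graph_hilbert (s : R) : s ^+ 2 = 1 ->
  hilbert_subspace (fun p q : D => s%:C * kform p q) (graph s).
Proof.
move=> s2; have ss : s%:C * s%:C = 1 :> R[i] by rewrite -rmorphM -expr2 s2.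
have formE p : p \in graph s -> s%:C * kform p p = (2 : R)%:C * kform p.1 p.1.
  move=> /eqP ps; rewrite -[kform p p]/(swap_form p p) /swap_form ps.
  rewrite (formZr hP.1) (formZl hP.1) conjc_real mulrDr !mulrA ss.
  by ring.
have graphB p q : p \in graph s -> q \in graph s -> p - q \in graph s.
  by move=> /eqP ps /eqP qs; apply/eqP; rewrite /= ps qs scalerBr.
have normE p : p \in graph s ->
    Num.sqrt (complex.Re (s%:C * kform p p)) = Num.sqrt 2 * seminorm kform p.1.
  move=> /formE ->; rewrite (sipxx hP) -rmorphM /=.
  by rewrite sqrtrM// sqrtr_sqr ger0_norm ?seminorm_ge0.
have s20 : 0 < Num.sqrt 2 :> R by rewrite sqrtr_gt0.
split.
- split; first by apply/eqP; rewrite /= scaler0.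
  move=> a p q /eqP ps /eqP qs; apply/eqP.
  by rewrite /= ps qs scalerDr !scalerA mulrC.
- move=> p pG p0; have c2 : 0 < (2 : R)%:C by rewrite (ltcR 0 2).
  rewrite formE// pmulr_rgt0// lt_neqAle kform_ge0 andbT.
  rewrite eq_sym; apply: contraNneq p0 => /kform_definite p1.
  by move: pG => /eqP; rewrite p1 scaler0 => p2; apply/eqP; case: (p) p1 p2 => ? ? /= -> ->.
- move=> u uG uC; have [|l _ ul] := @kform_complete R H (fun n => (u n).1) (fun=> isT).
    move=> e e0; have [|n0 hn0] := uC (Num.sqrt 2 * e); first exact: mulr_gt0.
    exists n0 => m n n0m n0n; have := hn0 m n n0m n0n.
    by rewrite normE ?graphB// ltr_pM2l.
  have lG : ((l, s%:C *: l) : D) \in graph s by apply/eqP.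
  exists (l, s%:C *: l) => //.
  apply/(converges_toP (fun=> sqrtr_ge0 _)) => e e0.
  have /(converges_toP (seminorm_ge0 _)) ul' := ul.
  have [|n0 hn0] := ul' (e / Num.sqrt 2); first exact: divr_gt0.
  exists n0 => n /hn0; rewrite normE ?graphB//.
  by rewrite ltr_pdivlMr// mulrC.
Qed.

Fact swap_decomposition : @fundamental_decomposition R D (graph 1) (graph (-1)).
Proof.
have half x : (2^-1)%:C *: (x + x) = x :> H by module R[i] H.
split.
- have := graph_hilbert (expr1n _ 2); congr hilbert_subspace.
  by apply/funext => p; apply/funext => q; rewrite mul1r.
- have := graph_hilbert (etrans (sqrrN 1) (expr1n _ 2)); congr hilbert_subspace.
  by apply/funext => p; apply/funext => q; rewrite rmorphN1 mulN1r.
- move=> p q /eqP ps /eqP qs; rewrite -[LHS]/(swap_form p q) /swap_form ps qs.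
  by rewrite rmorphN1 scaleN1r scale1r (formNr hP.1) addNr.
- move=> p /eqP + /eqP; rewrite scale1r rmorphN1 scaleN1r => p2 p2'.
  have p1 : p.1 = 0 by rewrite -(half p.1) -{1}p2 p2' addNr scaler0.
  by case: p p1 p2 {p2'} => u v /= -> ->.
- move=> p; exists ((2^-1)%:C *: (p.1 + p.2), (2^-1)%:C *: (p.1 + p.2)).
  exists ((2^-1)%:C *: (p.1 - p.2), (2^-1)%:C *: (p.2 - p.1)); split.
  + by apply/eqP; rewrite /= scale1r.
  + by apply/eqP; rewrite /= rmorphN1 scaleN1r -scalerN opprB.
  + by rewrite [LHS]surjective_pairing; congr (_, _) => /=; module R[i] H.
Qed.

HB.instance Definition _ :=
  isKreinSpace.Build R D (ex_intro _ _ (ex_intro _ _ swap_decomposition)).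

Definition swap_symmetry (p : D) : D := (p.2, p.1).

Lemma swap_symmetryP : @fundamental_symmetry R D swap_symmetry.
Proof.
exists (graph 1), (graph (-1)); split; first exact: swap_decomposition.
move=> p q /eqP ps /eqP qs; rewrite /swap_symmetry /= ps qs.
rewrite [RHS]surjective_pairing rmorphN1 scale1r scaleN1r.
by congr (_, _); rewrite /= ps qs rmorphN1 scale1r scaleN1r; module R[i] H.
Qed.

Lemma swap_hnorm p :
  hnorm swap_symmetry p ^+ 2 = seminorm kform p.1 ^+ 2 + seminorm kform p.2 ^+ 2.
Proof.
have E : kform p (swap_symmetry p) = kform p.1 p.1 + kform p.2 p.2 by [].
rewrite /hnorm E !(sipxx hP) -rmorphD /= sqr_sqrtr//.
by rewrite addr_ge0 ?sqr_ge0.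
Qed.

End SwapDouble.

(** A copy of [A] to carry the second involution; it is indexed by [alphaP] because the laws of that
    involution depend on this proof. *)
Definition twisted (R : realType) (A : starAlgType R) (alpha : A -> A)
  (alphaP : involutive_star_automorphism alpha) : Type := A.

Section Twisted.
Context (R : realType) (A : starAlgType R) (alpha : A -> A).
Context (alphaP : involutive_star_automorphism alpha).
Local Notation B := (twisted alphaP).

HB.instance Definition _ := UnitalAlgebra.on B.

Definition twisted_star (x : B) : B := alpha (star (x : A)).

Fact twisted_star_antilinear (a : R[i]) (x y : B) :
  twisted_star (a *: x + y) = a^*%C *: twisted_star x + twisted_star y.
Proof.
have [alpha_lin _ _ _] := alphaP.
by rewrite /twisted_star star_antilinear alpha_lin.
Qed.

Fact twisted_starK : involutive twisted_star.
Proof.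
have [_ _ alphaS alphaK] := alphaP => x.
by rewrite /twisted_star -alphaS starK alphaK.
Qed.

Fact twisted_starM (x y : B) :
  twisted_star (amul x y) = amul (twisted_star y) (twisted_star x).
Proof.
have [_ alphaM _ _] := alphaP.
by rewrite /twisted_star -[amul x y]/(amul (x : A) (y : A)) starM alphaM.
Qed.

HB.instance Definition _ := hasInvolution.Build R B
  twisted_star_antilinear twisted_starK twisted_starM.

End Twisted.

Lemma krein_representation (R : realType) (A : kreinCStarAlgType R) :
  exists (K : kreinSpaceType R) (pi : A -> (K -> K)),
    [/\ representation pi, injective pi & closed_operator_set (range pi)].
Proof.
have [N [alpha [HN alphaP NC]]] : krein_cstar_axiom A by exact: krein_cstarP.
pose B : starAlgType R := twisted alphaP.
have HB : @banach_algebra_norm R B N by exact: HN.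
have [H [rho [[rho_lin rho_op] [rho1 rhoM] rho_adj rho_le rho_ge]]] :=
  @gelfand_naimark R B N HB NC.
have [alpha_lin alphaM alphaS alphaK] := alphaP.
have alpha1 : alpha aone = aone.
  by rewrite -[LHS]amul1r -{2}[aone]alphaK -alphaM amul1l alphaK.
(* As [alpha] commutes with [star], it also commutes with the twisted involution, for which [N] is a
   C*-norm. *)
have alphaN x : N (alpha x) <= N x.
  apply: (@star_endomorphism_contractive R B N HB NC alpha) => // y.
  exact: (congr1 alpha (alphaS y)).
pose K : kreinSpaceType R := swap_double H.
pose pi (x : A) (p : K) : K := (rho x p.1, rho (alpha x) p.2).
pose J : K -> K := @swap_symmetry R H.
have Jf : fundamental_symmetry J := swap_symmetryP H.
have pi_lin : linear pi.
  move=> a x y; apply/funext => p.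
  by rewrite /pi alpha_lin !rho_lin.
have pi_op x : linear (pi x).
  by move=> a p q; rewrite /pi !rho_op.
have pi_le x p : hnorm J (pi x p) <= N x * hnorm J p.
  rewrite -(@ler_pXn2r _ 2) ?nnegrE ?mulr_ge0 ?hnorm_ge0 ?(bnorm_ge0 HN)//.
  rewrite exprMn !swap_hnorm mulrDr -!exprMn lerD//.
    by rewrite ler_pXn2r ?nnegrE ?mulr_ge0 ?seminorm_ge0 ?(bnorm_ge0 HN)//; exact: rho_le.
  rewrite ler_pXn2r ?nnegrE ?mulr_ge0 ?seminorm_ge0 ?(bnorm_ge0 HN)//.
  by rewrite (le_trans (rho_le _ _))// ler_wpM2r ?seminorm_ge0.
(* Vectors [(u, 0)] suffice, since the first component of [pi] is already isometric. *)
have pi_ge x M : 0 <= M -> (forall p, hnorm J (pi x p) <= M * hnorm J p) -> N x <= M.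
  move=> M0 xM; apply: rho_ge => // u.
  have rho0 : rho (alpha x) 0 = 0.
    by have := rho_op (alpha x) (-1) 0 0; rewrite scaler0 addr0 scaleN1r addNr.
  have left_norm (v : H) : hnorm J ((v, 0) : K) = seminorm kform v.
    apply/eqP; rewrite -(@eqrXn2 _ 2) ?hnorm_ge0 ?seminorm_ge0//.
    by rewrite swap_hnorm /= (seminorm0 (preHilbertP H)) expr0n addr0.
  by have := xM (u, 0); rewrite /pi /= rho0 !left_norm.
exists K, pi; split; last exact: (range_closed HN Jf pi_lin pi_op pi_le pi_ge).
  split.
  - exact: (operator_continuous HN Jf pi_op pi_le).
  - exact: pi_lin.
  - by apply/funext => -[u v]; rewrite /pi alpha1 rho1.
  - by move=> x y; apply/funext => p; rewrite /pi alphaM !rhoM.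
  - move=> x p q; rewrite /pi -[LHS]/(swap_form _ _) -[RHS]/(swap_form _ _).
    rewrite /swap_form /= -!rho_adj.
    (* The twisted adjoint of [alpha x] is [star x], and that of [x] is [alpha (star x)]: the two
       components of [pi (star x)]. *)
    by rewrite -[star (alpha x : B)]/(alpha (star (alpha x))) -alphaS alphaK.
move=> x y xy; apply/eqP; rewrite -subr_eq0; apply/eqP/(bnorm_eq0 HN)/eqP.
(* Here [pi_ge] is used with the bound [0], as [pi (x - y)] vanishes. *)
rewrite eq_le (bnorm_ge0 HN) andbT; apply: pi_ge => // p.
have -> : x - y = -1 *: y + x by module R[i] A.
rewrite pi_lin xy -[_ p]/(-1 *: pi y p + pi y p) scaleN1r addNr mul0r.
have [P _ _ _ _] := fundamental_symmetryP Jf.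
by rewrite [hnorm _ _](seminorm0 P).
Qed.

Theorem theorem3p8 (R : realType) (A : kreinCStarAlgType R) :
  (exists (K : kreinSpaceType R) (pi : A -> (K -> K)),
     representation pi /\ injective pi) /\
  (exists (K : kreinSpaceType R) (S : set (K -> K)),
     closed_unital_star_subalgebra S /\
     exists phi : A -> (K -> K),
       representation phi /\ set_bij [set: A] S phi).
Proof.
have [K [pi [pi_rep pi_inj pi_closed]]] := krein_representation A.
split; first by exists K, pi.
exists K, (range pi); split; last first.
  exists pi; split=> //; split=> // x y _ _; exact: pi_inj.
have [pi_cont pi_lin pi1 piM pi_adj] := pi_rep; split=> //.
- by move=> _ [x _ <-].
- by exists aone.
- split=> [a _ _ [x _ <-] [y _ <-]|_ _ [x _ <-] [y _ <-]].
    by exists (a *: x + y) => //; exact: pi_lin.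
  by exists (amul x y) => //; exact: piM.
- by move=> _ [x _ <-]; exists (pi (star x)) => //; exists (star x).
Qed.
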